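(* Let $\mathcal H$ be a complex Hilbert space of finite dimension $d\ge 3$, and let $w$ be a normalized context-indexed probability assignment on $\mathfrak M(\mathcal H)$. The following are equivalent: (1) $w$ is refinement consistent; (2) $w$ is context independent; (3) there is a unique density operator $\rho$ on $\mathcal H$ such that $w(P,\mathsf M)=\operatorname{Tr}(\rho P)$ for every projective measurement $\mathsf M$ and every $P\in\mathsf M$.
   Context: A projective measurement on $\mathcal H$ is an unordered finite family (set) $\mathsf M=\{P_1,\dots,P_m\}$ of nonzero pairwise orthogonal orthogonal projections on $\mathcal H$ with $\sum_{j=1}^m P_j=I$; $\mathfrak M(\mathcal H)$ is the set of all of them. A (normalized) context-indexed probability assignment on $\mathfrak M(\mathcal H)$ is a function $w:\{(P,\mathsf M):\mathsf M\in\mathfrak M(\mathcal H),\ P\in\mathsf M\}\to[0,1]$ with $\sum_{P\in\mathsf M}w(P,\mathsf M)=1$ for every $\mathsf M$. It is context independent if $w(P,\mathsf M)=w(P,\mathsf N)$ whenever $P\in\mathsf M\cap\mathsf N$. A measurement $\mathsf M'$ is an elementary refinement of $\mathsf M$ if there are an outcome $Q\in\mathsf M$ and nonzero mutually orthogonal projections $Q_1,Q_2$ with $Q=Q_1+Q_2$ and $\mathsf M'=(\mathsf M\setminus\{Q\})\cup\{Q_1,Q_2\}$. If $P\in\mathsf M\setminus\{Q\}$, write $\mathsf M'\succ_P\mathsf M$. The assignment $w$ is refinement consistent if $w(P,\mathsf M')=w(P,\mathsf M)$ whenever $\mathsf M'\succ_P\mathsf M$. A density operator is a positive semidefinite operator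 of trace one. *)

(* Defs.v *)
From HB Require Import structures.
From mathcomp Require Import all_boot all_order all_algebra.
From mathcomp Require Import finmap.
From mathcomp Require Import reals.
From mathcomp Require Import complex.

Set Implicit Arguments.
Unset Strict Implicit.
Unset Printing Implicit Defensive.

Import Order.TTheory GRing.Theory Num.Theory.

Local Open Scope fset_scope.
Local Open Scope ring_scope.
Local Open Scope complex_scope.

(* A finite-dimensional complex Hilbert space is a vectType H over R[i]
   (R : realType) together with a positive definite hermitian form, linear in
   its first argument; completeness is automatic in finite dimension. *)
Notation inner_product H := {dot H for Num.conj}.

(* Independent of the chosen basis, as the trace is invariant under conjugation. *)
Definition lfun_trace (R : realType) (H : vectType R[i]) (A : 'End(H)) : R[i] :=
  \tr (passmx.mxof (vbasis {:H}) (vbasis {:H}) A).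

Section Operators.
Context {R : realType} {H : vectType R[i]} (form : inner_product H).

Definition self_adjoint (A : 'End(H)) : Prop :=
  forall u v, form (A u) v = form u (A v).

Definition orthogonal_projection (P : 'End(H)) : Prop :=
  (P \o P)%VF = P /\ self_adjoint P.

(* The order of R[i] is partial: 0 <= z says that z is real and nonnegative. *)
Definition positive_semidefinite (A : 'End(H)) : Prop :=
  self_adjoint A /\ forall u, 0 <= form (A u) u.

Definition density_operator (rho : 'End(H)) : Prop :=
  positive_semidefinite rho /\ lfun_trace rho = 1.

Definition projective_measurement (M : {fset 'End(H)}) : Prop :=
  [/\ forall P, P \in M -> P != 0 /\ orthogonal_projection P,
      forall P Q, P \in M -> Q \in M -> P != Q -> (P \o Q)%VF = 0
    & \sum_(P <- M) P = \1%VF].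

Record measurement := Measurement {
  outcomes :> {fset 'End(H)};
  measurementP : projective_measurement outcomes }.

(* A measurement M coerces to the type of its outcomes, so the domain of an
   assignment consists exactly of the pairs (P, M) with P in M. *)
Record prob_assignment := ProbAssignment {
  weight :> forall M : measurement, M -> R;
  weight_range : forall (M : measurement) (P : M), 0 <= weight P <= 1;
  weight_sum : forall M : measurement, \sum_(P : M) weight P = 1 }.

Definition context_independent (w : prob_assignment) : Prop :=
  forall (M N : measurement) (P : 'End(H))
      (PM : P \in outcomes M) (PN : P \in outcomes N),
    w M [` PM] = w N [` PN].

(* M' is the elementary refinement of M that splits the outcome Q. *)
Definition elementary_refinement_at (Q : 'End(H)) (M' M : measurement) : Prop :=
  Q \in outcomes M /\
  exists Q1 Q2 : 'End(H),
    [/\ Q1 != 0 /\ orthogonal_projection Q1,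
        Q2 != 0 /\ orthogonal_projection Q2,
        (Q1 \o Q2)%VF = 0,
        Q = Q1 + Q2
      & outcomes M' = (outcomes M `\ Q) `|` [fset Q1; Q2]].

(* M' >_P M *)
Definition refines_keeping (P : 'End(H)) (M' M : measurement) : Prop :=
  exists2 Q, elementary_refinement_at Q M' M & P \in outcomes M `\ Q.

Definition refinement_consistent (w : prob_assignment) : Prop :=
  forall (M M' : measurement) (P : 'End(H))
      (PM : P \in outcomes M) (PM' : P \in outcomes M'),
    refines_keeping P M' M -> w M' [` PM'] = w M [` PM].

End Operators.

(* Main.v *)
(** (1) => (2): any measurement containing P reduces to {P, I - P} by merging two
    other outcomes at a time, and every such merge is undone by an elementary
    refinement that keeps P.

    (2) => (3) is Gleason's theorem.  Context independence gives a function mu on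
    projections that is additive on orthogonal pairs; restricted to the lines of a
    real three-dimensional span it is a frame function f: its values at the members
    of an orthogonal triple have a constant sum.

    Real part, after Piron, Gleason and Cooke-Keane-Moran, but with errors in place
    of compactness.  Let p be a near-minimum of f >= 0 and rho the quarter turn about
    p.  Then f + f.rho is constant on the equator of p, hence almost monotone along
    great circles tangent to a parallel; a spiral of a bounded number of such arcs
    joins any two points with a given gap of squared latitude, so f + f.rho almost
    depends on the squared latitude alone, additively, hence almost linearly.  If r
    is a near-maximum orthogonal to p, the same holds at r, and subtracting the
    quadratic form with the same values at p, r and p x r leaves a frame function h of
    weight 0 that almost changes sign under both quarter turns.  Thus h almost vanishes
    on the six planes x = +-y, y = +-z, x = +-z; but near its supremum D the same
    estimate gives h >= D (3 l - 2), l the squared cosine of the distance, and some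
    mirror point has l >= 9/10.  So D is almost 0 and f is a quadratic form.

    Complex part: F v = |v|^2 mu(v) is then quadratic on real planes.  On a complex
    plane spanned by orthonormal e1, e2 the lines of e1 + w e2, |w| = 1, form a second
    great circle of the Bloch sphere, so F is quadratic there too.  Hence F satisfies
    the parallelogram law, and polarization produces the density operator. *)
Require Import Defs.
From HB Require Import structures.
From mathcomp Require Import all_boot all_order all_algebra.
From mathcomp Require Import finmap.
From mathcomp Require Import reals.
From mathcomp Require Import complex.
From mathcomp Require Import boolp classical_sets ring lra.

Set Implicit Arguments.
Unset Strict Implicit.
Unset Printing Implicit Defensive.

Import Order.TTheory GRing.Theory Num.Theory.

Local Open Scope fset_scope.
Local Open Scope ring_scope.
Local Open Scope complex_scope.

(** * Products of small rotations *)

Section ComplexFactorization.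
Variable R : realType.
Implicit Types (c z : R[i]) (a b : R).

Definition sqnormc z : R := complex.Re z ^+ 2 + complex.Im z ^+ 2.

Lemma sqnormcM z c : sqnormc (z * c) = sqnormc z * sqnormc c.
Proof. by case: z c => [a b] [p q]; rewrite /sqnormc /=; ring. Qed.

Lemma sqnormcX z n : sqnormc (z ^+ n) = sqnormc z ^+ n.
Proof.
elim: n => [|n IH]; first by rewrite /sqnormc !expr0 /=; ring.
by rewrite !exprS sqnormcM IH.
Qed.

Lemma bernoulli_inv (x : R) n : 0 <= x -> (1 + x) ^+ n * (1 - n%:R * x) <= 1.
Proof.
move=> x0; elim: n => [|n IH]; first by rewrite expr0; lra.
apply: le_trans IH; rewrite exprS [(1 + x) * _]mulrC -mulrA.
apply: ler_wpM2l; first by apply: exprn_ge0; lra.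
rewrite -[n.+1%:R]natr1; have := ler0n R n; nra.
Qed.

Lemma sqrt_rhp c : c != 0 -> exists a b,
  [/\ (a +i* b) ^+ 2 = c, 0 <= a & a ^+ 2 - b ^+ 2 = complex.Re c].
Proof.
move=> c0; have := sqrtCK c; case: (sqrtC c) => a b E.
have [a0|a0] := leP 0 a.
  by exists a, b; split=> //; rewrite -E expr2 /=; ring.
exists (- a), (- b); split; last by rewrite -E expr2 /=; ring.
  by rewrite -E -[RHS]sqrrN; congr (_ ^+ 2); simpc.
by lra.
Qed.

(** Two square roots in the right half-plane bring the angle within an eighth of a turn, whence
    [b ^+ 2 <= a ^+ 2]; every further root at least halves the slope [b / a]. *)
Lemma dyadic_root j c : c != 0 -> exists a b,
  [/\ (a +i* b) ^+ (2 ^ (j + 2)) = c, 0 < a & b ^+ 2 * 4 ^+ j <= a ^+ 2].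
Proof.
move=> c0; elim: j => [|j [a [b [E a0 ab]]]].
  have [a [b [E a0 _]]] := sqrt_rhp c0.
  have w0 : a +i* b != 0 by apply: contra c0 => /eqP w0; rewrite -E w0 expr0n.
  have [p [q [F p0 /= pq]]] := sqrt_rhp w0.
  have {}p0 : 0 < p.
    rewrite lt0r p0 andbT; apply: contra w0 => /eqP p1; rewrite -F p1 in pq *.
    have -> : q = 0 by apply/eqP; rewrite -sqrf_eq0; apply/eqP; nra.
    by rewrite expr0n.
  exists p, q; split=> //; first by rewrite add0n (exprM _ 2 2) F.
  by rewrite expr0; lra.
have w0 : a +i* b != 0.
  by apply/eqP => -[a1 _]; move: a0; rewrite a1 ltxx.
have [p [q [F p0 /= pq]]] := sqrt_rhp w0.
have aE : b = 2 * p * q by move: F; rewrite expr2 => -[_ <-]; ring.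
have {}p0 : 0 < p.
  rewrite lt0r p0 andbT; apply/eqP => p1.
  by move: a0; rewrite -pq p1 expr0n sub0r oppr_gt0 ltNge sqr_ge0.
exists p, q; split=> //; first by rewrite addSn expnS exprM F.
have le1 : a ^+ 2 <= (p ^+ 2) ^+ 2 by rewrite ler_sqr ?nnegrE; nra.
have : (p ^+ 2) * (q ^+ 2 * 4 ^+ j.+1) <= p ^+ 2 * p ^+ 2.
  rewrite -[X in _ <= X]expr2; apply: le_trans le1; apply: le_trans ab.
  rewrite aE [4 ^+ j.+1]exprS; move: (4 ^+ j) => y.
  by rewrite [leRHS](_ : _ = p ^+ 2 * (q ^+ 2 * (4 * y))) //; ring.
by rewrite ler_pM2l // exprn_gt0.
Qed.

(** If [a + ib] is a root of order [n] of [c], then [c] is [a ^+ n] times the [n]-th power of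
    [1 + i b / a]. The real factor has the form [1 + s ^+ 2] as soon as [a >= 1]. *)
Lemma complex_factorization (g : R) : 0 < g -> exists n, forall c,
  1 + g <= sqnormc c -> exists t s,
  c = (1 +i* t) ^+ n * ((1 +i* s) * (1 +i* (- s))).
Proof.
move=> g0; pose j := (Num.truncn (4 * (1 + g) / g)).+1.
exists (2 ^ (j + 2))%N => c gc.
have c0 : c != 0 by apply: contraTneq gc => ->; rewrite /sqnormc /= -ltNge; nra.
have [a [b [E a0 ab]]] := dyadic_root j c0.
set n := (2 ^ (j + 2))%N in E *.
have nE : n%:R = 4 * 2 ^+ j :> R by rewrite /n expnD natrM natrX mulrC.
have jP : 4 * (1 + g) / g < 2 ^+ j.
  have /lt_trans : 4 * (1 + g) / g < j%:R by exact: truncnS_gt.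
  apply.
  by rewrite -natrX ltr_nat ltn_expl.
have p2 : 0 < 2 ^+ j :> R by rewrite exprn_gt0.
(* If [a < 1], the root has squared modulus at most [1 + x] with [x] the inverse of [4 ^+ j], and
   [c] at most [(1 + x) ^+ n]. Since [n x = 4 / 2 ^ j], the choice of [j] makes this less than
   [1 + g]. *)
have a1 : 1 <= a.
  rewrite leNgt; apply/negP => a1.
  have a2 : a ^+ 2 <= 1 by nra.
  pose x : R := (4 ^+ j)^-1.
  have x0 : 0 < x by rewrite invr_gt0 exprn_gt0.
  have x4 : x * 4 ^+ j = 1 by rewrite mulVf // expf_neq0 // pnatr_eq0.
  have b2 : b ^+ 2 <= x.
    have : x * (b ^+ 2 * 4 ^+ j) <= x * a ^+ 2 by rewrite ler_pM2l.
    by rewrite mulrCA x4; nra.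
  have xn : n%:R * x * 2 ^+ j = 4.
    have e4 : 4 ^+ j = 2 ^+ j * 2 ^+ j :> R by rewrite -exprMn -natrM.
    by transitivity (4 * (x * 4 ^+ j)); [rewrite nE e4; ring | rewrite x4 mulr1].
  have h1 : 1 + g <= (1 + x) ^+ n.
    apply: (le_trans gc); rewrite -E sqnormcX.
    apply: lerXn2r; rewrite ?nnegrE /sqnormc /=; nra.
  have h2 := bernoulli_inv n (ltW x0).
  have h3 : 4 * (1 + g) < 2 ^+ j * g by rewrite -ltr_pdivrMr.
  have h4 : n%:R * x * (1 + g) < g.
    rewrite -(ltr_pM2l p2) mulrCA mulrC; nra.
  have h5 : 0 < 1 - n%:R * x by nra.
  have : (1 + g) * (1 - n%:R * x) <= 1.
    by apply: le_trans h2; rewrite ler_wpM2r // ltW.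
  nra.
exists (b / a), (Num.sqrt (a ^+ n - 1)).
have an1 : 1 <= a ^+ n by rewrite exprn_ege1.
have -> : (1 +i* Num.sqrt (a ^+ n - 1)) * (1 +i* (- Num.sqrt (a ^+ n - 1)))
          = (a ^+ n)%:C.
  have := sqr_sqrtr (_ : 0 <= a ^+ n - 1); rewrite subr_ge0 => /(_ an1).
  move: (Num.sqrt _) => s sE; simpc; congr (_ +i* _); last by ring.
  by rewrite -expr2 sE; ring.
rewrite rmorphXn -exprMn -E; congr (_ ^+ _).
have ab0 : b / a * a = b by rewrite divfK // gt_eqF.
by simpc; rewrite ?mul1r ab0.
Qed.

End ComplexFactorization.

(** * Functions that are additive and almost monotone in the squared latitude *)

Section AdditiveOnLatitude.
Variables (R : realType) (T : Type) (k lat : T -> R) (K B e : R) (N : nat) (p : T).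
Hypotheses (N0 : (0 < N)%N) (KB : K <= B) (B0 : 0 <= B) (e0 : 0 <= e).
Hypothesis lat01 : forall u, 0 <= lat u <= 1.
Hypothesis latp : lat p = 1.
Hypothesis kp : k p = K.
Hypothesis split : forall u (a b : R), 0 <= a -> 0 <= b -> a + b = lat u ->
  exists s t, [/\ lat s = a, lat t = b & k u = k s + k t].
Hypothesis flip : forall u, exists v, lat v = 1 - lat u /\ k u + k v = K.
Hypothesis mono : forall u v, lat u + (N%:R * N.+1%:R)^-1 <= lat v -> k u <= k v + e.
Hypothesis top : forall u, k u <= K + e.

Let Np : 0 < N%:R :> R. Proof. by rewrite ltr0n. Qed.
Let Sp : 0 < N.+1%:R :> R. Proof. by rewrite ltr0n. Qed.

(** Cutting [u] into [m.+1] parts with [lat] equal to [1 / N] preserves the total value, and the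
    smallest part is at most the mean. *)
Lemma exists_small_part m u : lat u = m.+1%:R / N%:R ->
  exists s, lat s = N%:R^-1 /\ m.+1%:R * k s <= k u.
Proof.
elim: m u => [|m IH] u lu; first by exists u; rewrite lu !mul1r.
have iN : 0 <= (N%:R^-1 : R) by rewrite invr_ge0 ltW.
have mN : 0 <= m.+1%:R / N%:R :> R by rewrite divr_ge0 // ltW.
have [|s [t [ls lt ->]]] := @split u _ _ iN mN _.
  by rewrite lu -[m.+2%:R]natr1; ring.
have [s1 [ls1 ks1]] := IH _ lt.
have m0 : 0 < m.+1%:R :> R by rewrite ltr0n.
rewrite -[m.+2%:R]natr1.
by have [h|h] := leP (k s) (k s1); [exists s | exists s1]; split=> //; nra.
Qed.

(** The pole has a part with [lat] equal to [1 / N] and value at most [K / N]. The difference of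
    [1 / N] and [1 / N.+1] is exactly the gap in [mono]. *)
Lemma point_of_small_latitude u : lat u = N.+1%:R^-1 -> k u <= K / N%:R + e.
Proof.
move=> lu; have NE : N.-1.+1 = N by rewrite prednK.
have [|s [ls ks]] := @exists_small_part N.-1 p.
  by rewrite latp NE divff ?gt_eqF.
rewrite NE kp in ks; apply: le_trans (mono (v := s) _) _.
  rewrite lu ls le_eqVlt; apply/orP; left; apply/eqP.
  rewrite -[N.+1%:R]natr1; field.
  by rewrite natr1 !pnatr_eq0 -!lt0n N0.
by rewrite lerD2r ler_pdivlMr // mulrC.
Qed.

Lemma point_of_latitude m u : lat u = m%:R / N.+1%:R -> (0 < m)%N ->
  k u <= m%:R * (K / N%:R + e).
Proof.
elim: m u => // -[|m] IH u lu _.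
  by rewrite mul1r; apply: point_of_small_latitude; rewrite lu mul1r.
have iN : 0 <= (N.+1%:R^-1 : R) by rewrite invr_ge0 ltW.
have mN : 0 <= m.+1%:R / N.+1%:R :> R by rewrite divr_ge0 // ltW.
have [|s [t [ls lt ->]]] := @split u _ _ iN mN _.
  by rewrite lu -[m.+2%:R]natr1; ring.
have h1 := point_of_small_latitude ls.
have h2 := IH _ lt isT.
by rewrite -[m.+2%:R]natr1 mulrDl mul1r; lra.
Qed.

(** Compare [u] by [mono] with a point [v] whose [lat] is a multiple of [1 / N.+1] at least one unit
    above [lat u]; cutting [v] into units bounds [k v]. Near the pole, where no such multiple is at
    most 1, [top] suffices. *)
Lemma latitude_upper_bound u : k u <= K * lat u + 3 * B / N%:R + (N%:R + 3) * e.
Proof.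
have [KB' B0' e0'] := And3 KB B0 e0; have /andP[l0 l1] := lat01 u.
pose m := Num.truncn (N.+1%:R * lat u).
have /andP[m1 m2] : m%:R <= N.+1%:R * lat u < m.+1%:R.
  by apply: truncn_itv; rewrite mulr_ge0 // ltW.
pose y := (N%:R : R)^-1.
have y0 : 0 < y by rewrite invr_gt0.
have yN : N%:R * y = 1 by rewrite mulfV // gt_eqF.
have -> : 3 * B / N%:R = 3 * B * y by [].
rewrite -[m.+1%:R]natr1 -[N.+1%:R]natr1 in m2; rewrite -[N.+1%:R]natr1 in m1.
have [mN|mN] := leqP m.+2 N.+1.
  have h0 : 0 <= m.+2%:R / N.+1%:R :> R by rewrite divr_ge0 // ltW.
  have h1 : 0 <= 1 - m.+2%:R / N.+1%:R :> R.
    by rewrite subr_ge0 ler_pdivrMr // mul1r ler_nat.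
  (* Splitting the pole serves only to produce a point of the prescribed latitude. *)
  have [|v [_ [lv _ _]]] := @split p _ _ h0 h1 _; first by rewrite latp; ring.
  have kv := point_of_latitude lv isT.
  have kuv : k u <= k v + e.
    apply: mono; rewrite lv.
    have h2 : (N%:R * N.+1%:R)^-1 <= N.+1%:R^-1 :> R.
      rewrite lef_pV2 ?posrE ?mulr_gt0 //.
      by rewrite ler_peMl // ?ler1n // ltW.
    have h3 : lat u <= m.+1%:R / N.+1%:R.
      by rewrite ler_pdivlMr // -[m.+1%:R]natr1 -[N.+1%:R]natr1; nra.
    rewrite -[m.+2%:R]natr1 mulrDl mul1r.
    exact: lerD.
  have mN' : m.+2%:R <= N%:R + 1 :> R by rewrite natr1 ler_nat.
  have m2E : m.+2%:R = m%:R + 2 :> R by rewrite -!natr1; ring.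
  rewrite m2E in kv mN'; rewrite -/y in kv.
  have h4 : K * ((m%:R + 2) * y - lat u) <= 3 * B * y.
    have h5 : 0 <= (m%:R + 2) * y - lat u.
      have : 0 <= y * (m%:R + 2 - N%:R * lat u) by apply: mulr_ge0; [exact: ltW | nra].
      by rewrite mulrBr mulrA [y * N%:R]mulrC yN; lra.
    have h6 : (m%:R + 2) * y - lat u <= 3 * y.
      have : 0 <= y * (N%:R * lat u + 3 - (m%:R + 2)) by apply: mulr_ge0; [exact: ltW | nra].
      by rewrite mulrBr mulrDr mulrA [y * N%:R]mulrC yN; lra.
    apply: le_trans (_ : B * ((m%:R + 2) * y - lat u) <= _).
      by rewrite ler_wpM2r.
    by rewrite [leRHS]mulrAC [3 * y * B]mulrC ler_wpM2l.
  have h7 : (m%:R + 2) * e <= (N%:R + 1) * e by rewrite ler_wpM2r.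
  by clear h0 h1; nra.
have mN' : N%:R + 1 <= m%:R + 1 :> R by rewrite !natr1 ler_nat.
have h1 := top u.
have h2 : (1 - lat u) <= y.
  have : 0 <= y * (N%:R * lat u + 1 - N%:R) by apply: mulr_ge0; [exact: ltW | nra].
  by rewrite mulrBr mulrDr mulrA [y * N%:R]mulrC yN; lra.
have h3 : K * (1 - lat u) <= 3 * B * y.
  apply: le_trans (_ : B * (1 - lat u) <= _); first by rewrite ler_wpM2r // subr_ge0.
  by nra.
have h4 : 0 <= N%:R * e by rewrite mulr_ge0 // ltW.
by nra.
Qed.

(** The lower bound is the upper bound at the flipped point, where the value is [K - k u]. *)
Lemma latitude_bound u : `|k u - K * lat u| <= 3 * B / N%:R + (N%:R + 3) * e.
Proof.
have h1 := latitude_upper_bound u.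
have [v [lv kv]] := flip u.
have h2 := latitude_upper_bound v.
by rewrite ler_norml; apply/andP; split; [move: h2; rewrite lv|]; lra.
Qed.

End AdditiveOnLatitude.

(** * Frame functions on real 3-space *)

Section Frames.
Variable R : realType.
Implicit Types (f k : R -> R -> R -> R) (x y z W K eps g : R).

Definition sqn x y z : R := x ^+ 2 + y ^+ 2 + z ^+ 2.

(* [f x y z] stands for the value on the line of (x, y, z); the value at the origin is junk. *)
Definition frame_function (W : R) f : Prop :=
  (forall c x y z : R, c != 0 -> f (c * x) (c * y) (c * z) = f x y z) /\
  (forall x1 y1 z1 x2 y2 z2 x3 y3 z3 : R,
    0 < sqn x1 y1 z1 -> 0 < sqn x2 y2 z2 -> 0 < sqn x3 y3 z3 ->
    x1 * x2 + y1 * y2 + z1 * z2 = 0 ->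
    x1 * x3 + y1 * y3 + z1 * z3 = 0 ->
    x2 * x3 + y2 * y3 + z2 * z3 = 0 ->
    f x1 y1 z1 + f x2 y2 z2 + f x3 y3 z3 = W).

(* The square of the sine of the latitude. *)
Definition lat x y z : R := z ^+ 2 / sqn x y z.

(** Models [W - f 0 0 1] minus the sum of [f] and its quarter turn, for a frame function [f] with a
    near-minimum at the pole. *)
Definition polar_frame K eps k : Prop :=
  [/\ frame_function K k, k 0 0 1 = K,
      forall x y : R, 0 < x ^+ 2 + y ^+ 2 -> k x y 0 = 0
    & forall x y z : R, 0 < sqn x y z -> - eps <= k x y z].

Lemma sqn_gt0 x y z : (0 < sqn x y z) = [|| x != 0, y != 0 | z != 0].
Proof.
have := sqr_ge0 x; have := sqr_ge0 y; have := sqr_ge0 z.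
rewrite -(sqrf_eq0 x) -(sqrf_eq0 y) -(sqrf_eq0 z) /sqn => z0 y0 x0.
rewrite lt0r addr_ge0 ?addr_ge0 // andbT.
by rewrite !paddr_eq0 ?addr_ge0 // !negb_and orbA.
Qed.

Lemma lat_ge0 x y z : 0 < sqn x y z -> 0 <= lat x y z.
Proof. by move=> u0; rewrite divr_ge0 ?sqr_ge0 // ltW. Qed.

Lemma lat_le1 x y z : 0 < sqn x y z -> lat x y z <= 1.
Proof. by move=> u0; rewrite ler_pdivrMr // mul1r /sqn; nra. Qed.

(* In the chart z = 1 a step along the tangent circle is multiplication by [1 + i t]. *)
Definition planar k (z : R[i]) : R := k (complex.Re z) (complex.Im z) 1.

Section Polar.
Variables (K eps : R) (k : R -> R -> R -> R).
Hypothesis kP : polar_frame K eps k.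

Lemma polar_eps_ge0 : 0 <= eps.
Proof.
have [_ _ ke kge] := kP; have : 0 < sqn 1 0 0 by rewrite /sqn; lra.
by move=> /kge; rewrite ke; [lra | nra].
Qed.

Lemma polar_pole c : c != 0 -> k 0 0 c = K.
Proof.
have [[kh _] kp _ _] := kP => c0.
by have := kh c 0 0 1 c0; rewrite !mulr0 mulr1 kp.
Qed.

(** The point a quarter turn away on the same meridian completes [(x, y, z)] and an equator point to
    an orthogonal triple, and [k] vanishes on the equator. At the pole any equator point will do. *)
Lemma polar_flip x y z : 0 < sqn x y z -> exists x' y' z',
  [/\ 0 < sqn x' y' z', lat x' y' z' = 1 - lat x y z & k x y z + k x' y' z' = K].
Proof.
have [[kh ks] kp ke _] := kP => u0.
have [r0|r0] := eqVneq (x ^+ 2 + y ^+ 2) 0.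
  have [/eqP x0 /eqP y0] : x == 0 /\ y == 0.
    apply/andP; rewrite -(sqrf_eq0 x) -(sqrf_eq0 y).
    by rewrite -paddr_eq0 ?sqr_ge0 // r0.
  move: u0; rewrite {}x0 {}y0 => u0.
  have z0 : z != 0 by move: u0; rewrite sqn_gt0 !eqxx.
  exists 1, 0, 0; rewrite polar_pole // ke; last by lra.
  split; [by rewrite /sqn; lra | | by lra].
  by rewrite /lat /sqn !expr0n !add0r mul0r divff ?sqrf_eq0 // subrr.
have {}r0 : 0 < x ^+ 2 + y ^+ 2 by rewrite lt0r r0 addr_ge0 ?sqr_ge0.
have uE : sqn (- x * z) (- y * z) (x ^+ 2 + y ^+ 2) = (x ^+ 2 + y ^+ 2) * sqn x y z.
  by rewrite /sqn; ring.
have v0 : 0 < sqn (- x * z) (- y * z) (x ^+ 2 + y ^+ 2) by rewrite uE mulr_gt0.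
exists (- x * z), (- y * z), (x ^+ 2 + y ^+ 2); split=> //.
  rewrite /lat uE; move: u0; rewrite /sqn => u0.
  by field; rewrite !gt_eqF.
have n0 : 0 < sqn (- y) x 0 by rewrite /sqn; nra.
have := ks _ _ _ _ _ _ _ _ _ u0 v0 n0.
rewrite (ke (- y)); last by nra.
by rewrite addr0; apply; ring.
Qed.

Lemma polar_top x y z : 0 < sqn x y z -> k x y z <= K + eps.
Proof.
move=> u0; have [x' [y' [z' [v0 _ kuv]]]] := polar_flip u0.
by have [_ _ _ /(_ _ _ _ v0)] := kP; lra.
Qed.

(** The equator vector [(p, q, 0)] is orthogonal to [(x, y, z)], has the same length, and [k] is 0
    there. Turning the pair in its plane keeps the normal, hence the sum of the two values; the new
    heights [a * z] and [- b * z] share out the squared latitude. *)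
Lemma polar_turn x y z p q a b : 0 < sqn x y z ->
  x * p + y * q = 0 -> p ^+ 2 + q ^+ 2 = sqn x y z -> a ^+ 2 + b ^+ 2 = 1 ->
  [/\ sqn (a * x + b * p) (a * y + b * q) (a * z) = sqn x y z,
      sqn (- b * x + a * p) (- b * y + a * q) (- b * z) = sqn x y z &
      k x y z = k (a * x + b * p) (a * y + b * q) (a * z) +
                k (- b * x + a * p) (- b * y + a * q) (- b * z)].
Proof.
have [[kh ks] kp ke _] := kP => u0 o1 pq ab.
have s1 : sqn (a * x + b * p) (a * y + b * q) (a * z) = sqn x y z.
  transitivity (a ^+ 2 * sqn x y z + b ^+ 2 * (p ^+ 2 + q ^+ 2)
                + 2 * a * b * (x * p + y * q)); first by rewrite /sqn; ring.
  by rewrite pq o1 mulr0 addr0 -mulrDl ab mul1r.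
have s2 : sqn (- b * x + a * p) (- b * y + a * q) (- b * z) = sqn x y z.
  transitivity (b ^+ 2 * sqn x y z + a ^+ 2 * (p ^+ 2 + q ^+ 2)
                - 2 * a * b * (x * p + y * q)); first by rewrite /sqn; ring.
  by rewrite pq o1 mulr0 subr0 -mulrDl addrC ab mul1r.
split=> //.
have n0 : 0 < sqn (- z * q) (z * p) (x * q - y * p).
  have -> : sqn (- z * q) (z * p) (x * q - y * p)
     = (p ^+ 2 + q ^+ 2) * sqn x y z - (x * p + y * q) ^+ 2 by rewrite /sqn; ring.
  by rewrite o1 pq expr0n subr0 mulr_gt0.
have s1' : 0 < sqn (a * x + b * p) (a * y + b * q) (a * z) by rewrite s1.
have s2' : 0 < sqn (- b * x + a * p) (- b * y + a * q) (- b * z) by rewrite s2.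
have e1 : 0 < sqn p q 0 by move: u0; rewrite -pq /sqn expr0n addr0.
have st : (a * x + b * p) * (- b * x + a * p) +
     (a * y + b * q) * (- b * y + a * q) + a * z * (- b * z) = 0.
  transitivity (a * b * ((p ^+ 2 + q ^+ 2) - sqn x y z)
     + (a ^+ 2 - b ^+ 2) * (x * p + y * q)); first by rewrite /sqn; ring.
  by rewrite pq o1 subrr !mulr0 addr0.
have h1 := ks _ _ _ _ _ _ _ _ _ s1' s2' n0 st.
have h2 := ks _ _ _ _ _ _ _ _ _ u0 e1 n0.
rewrite (ke p) in h2; last by rewrite pq.
apply: (addIr (k (- z * q) (z * p) (x * q - y * p))).
rewrite h1; [|ring|ring].
by rewrite -[X in X + _]addr0 h2 // ?mulr0 ?addr0 //; ring.
Qed.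

Lemma equator_companion x y z : 0 < sqn x y z ->
  exists p q, x * p + y * q = 0 /\ p ^+ 2 + q ^+ 2 = sqn x y z.
Proof.
move=> u0; have [r0|r0] := eqVneq (x ^+ 2 + y ^+ 2) 0.
  have [/eqP x0 /eqP y0] : x == 0 /\ y == 0.
    apply/andP; rewrite -(sqrf_eq0 x) -(sqrf_eq0 y).
    by rewrite -paddr_eq0 ?sqr_ge0 // r0.
  by exists z, 0; rewrite x0 y0 /sqn; split; ring.
have {}r0 : 0 < x ^+ 2 + y ^+ 2 by rewrite lt0r r0 addr_ge0 ?sqr_ge0.
have := sqr_sqrtr (_ : 0 <= sqn x y z / (x ^+ 2 + y ^+ 2)).
rewrite divr_ge0 ?ltW // => /(_ isT); move: (Num.sqrt _) => m mE.
exists (- m * y), (m * x); split; first by ring.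
transitivity (m ^+ 2 * (x ^+ 2 + y ^+ 2)); first by ring.
by rewrite mE divfK // gt_eqF.
Qed.

Lemma polar_split x y z a b : 0 < sqn x y z -> 0 <= a -> 0 <= b -> a + b = lat x y z ->
  exists x1 y1 z1 x2 y2 z2, [/\ 0 < sqn x1 y1 z1, 0 < sqn x2 y2 z2,
    lat x1 y1 z1 = a, lat x2 y2 z2 = b & k x y z = k x1 y1 z1 + k x2 y2 z2].
Proof.
move=> u0 a0 b0 ab.
have [z0|z0] := eqVneq z 0.
  move: u0 ab; rewrite {}z0 => u0 ab.
  have l0 : lat x y 0 = 0 by rewrite /lat expr0n mul0r.
  exists x, y, 0, x, y, 0; split=> //; try by rewrite l0; lra.
  have [_ _ ke _] := kP; rewrite ke ?addr0 //.
  by move: u0; rewrite /sqn expr0n addr0.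
have l0 : 0 < lat x y z by rewrite divr_gt0 // lt0r sqrf_eq0 z0 sqr_ge0.
have [p [q [o1 pq]]] := equator_companion u0.
have sqrtE c : 0 <= c -> exists s : R, s ^+ 2 = c / lat x y z.
  by move=> c0; exists (Num.sqrt (c / lat x y z)); rewrite sqr_sqrtr // divr_ge0 // ltW.
have [s sE] := sqrtE _ a0; have [t tE] := sqrtE _ b0.
have st : s ^+ 2 + t ^+ 2 = 1 by rewrite sE tE -mulrDl ab divff ?gt_eqF.
have [e1 e2 e3] := polar_turn u0 o1 pq st.
exists (s * x + t * p), (s * y + t * q), (s * z),
  (- t * x + s * p), (- t * y + s * q), (- t * z).
split; rewrite ?e1 ?e2 //.
  by rewrite /lat e1 exprMn sE -mulrA -/(lat x y z) divfK // gt_eqF.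
by rewrite /lat e2 exprMn sqrrN tE -mulrA -/(lat x y z) divfK // gt_eqF.
Qed.

(* The line z = 1 through (x, y) perpendicular to the radius is the great circle that
   touches the parallel of (x, y, 1); it contains an equator point, where [k] vanishes. *)
Lemma polar_step x y t : k (x - t * y) (y + t * x) 1 <= k x y 1 + eps.
Proof.
have e0 := polar_eps_ge0; have [[kh ks] kp ke kge] := kP.
have [r0|r0] := eqVneq (x ^+ 2 + y ^+ 2) 0.
  have [/eqP -> /eqP ->] : x == 0 /\ y == 0.
    apply/andP; rewrite -(sqrf_eq0 x) -(sqrf_eq0 y).
    by rewrite -paddr_eq0 ?sqr_ge0 // r0.
  by rewrite !mulr0 subr0 addr0; lra.
have {}r0 : 0 < x ^+ 2 + y ^+ 2 by rewrite lt0r r0 addr_ge0 ?sqr_ge0.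
pose r := x ^+ 2 + y ^+ 2.
have r1 : 0 < r by [].
have u0 : 0 < sqn x y 1 by rewrite /sqn; nra.
(* The normal of the tangent great circle. It belongs both to the triple of [(x, y, 1)] with the
   equator point [(- y, x, 0)] and to that of the moved point with the vector in [tE]. *)
have n0 : 0 < sqn (- x) (- y) r by rewrite /sqn; nra.
have e1 : 0 < sqn (- y) x 0 by rewrite /sqn; nra.
have s0 : 0 < sqn (x - t * y) (y + t * x) 1 by rewrite /sqn; nra.
have tE : sqn (- (t * r * x) - (1 + r) * y) (- (t * r * y) + (1 + r) * x) (- (t * r))
  = r * ((t * r) ^+ 2 + (1 + r) ^+ 2) + (t * r) ^+ 2 by rewrite /sqn /r; ring.
have t0 : 0 < sqn (- (t * r * x) - (1 + r) * y) (- (t * r * y) + (1 + r) * x) (- (t * r)).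
  rewrite tE; have := sqr_ge0 (t * r); have : 0 < (1 + r) ^+ 2 by rewrite exprn_gt0; lra.
  by move=> h1 h2; nra.
have h1 := ks _ _ _ _ _ _ _ _ _ u0 e1 n0.
have h2 := ks _ _ _ _ _ _ _ _ _ s0 t0 n0.
have h3 := kge _ _ _ t0.
rewrite (ke (- y) x) in h1; last by nra.
have {}h1 : k x y 1 + 0 + k (- x) (- y) r = K by apply: h1; rewrite /r; ring.
have {}h2 : k (x - t * y) (y + t * x) 1 + k (- (t * r * x) - (1 + r) * y)
    (- (t * r * y) + (1 + r) * x) (- (t * r)) + k (- x) (- y) r = K.
  by apply: h2; rewrite /r; ring.
lra.
Qed.

Lemma planar_step (z : R[i]) t : planar k ((1 +i* t) * z) <= planar k z + eps.
Proof.
case: z => x y; have := polar_step x y t; rewrite /planar /=.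
have -> : 1 * x - t * y = x - t * y by ring.
by have -> : 1 * y + t * x = y + t * x by ring.
Qed.

Lemma planar_spiral (z : R[i]) t n :
  planar k ((1 +i* t) ^+ n * z) <= planar k z + n%:R * eps.
Proof.
elim: n => [|n IH]; first by rewrite expr0 mul1r mul0r addr0.
rewrite exprS -mulrA -natr1 mulrDl mul1r.
by have := planar_step ((1 +i* t) ^+ n * z) t; lra.
Qed.

End Polar.

(** In the chart z = 1, [lat] is the inverse of 1 plus the squared modulus, so a gap [g] forces
    [1 + g <= sqnormc c] for the quotient [c] of the two points. Factoring [c] gives a spiral of
    [n + 2] tangent steps, each costing [eps]. *)
Lemma polar_mono g : 0 < g -> exists n : nat, forall K eps k, polar_frame K eps k ->
  forall x y z x' y' z', 0 < sqn x y z -> 0 < sqn x' y' z' ->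
  lat x y z + g <= lat x' y' z' -> k x y z <= k x' y' z' + n%:R * eps.
Proof.
move=> g0; have [n nP] := complex_factorization g0.
exists (n + 2)%N => K eps k kP x y z x' y' z' u0 v0 uv.
have [[kh ks] kp ke kge] := kP; have eps0 := polar_eps_ge0 kP.
have neps : 0 <= n%:R * eps by rewrite mulr_ge0.
rewrite natrD mulrDl.
have [z0|z0] := eqVneq z 0.
  rewrite z0 ke; last by move: u0; rewrite z0 /sqn expr0n addr0.
  by have := kge _ _ _ v0; lra.
have lu := lat_ge0 u0.
have z'0 : z' != 0.
  apply: contraTneq uv => ->; have -> : lat x' y' 0 = 0 by rewrite /lat expr0n mul0r.
  by rewrite -ltNge; lra.
have normal (a b c : R) : c != 0 -> k a b c = k (a / c) (b / c) 1.
  by move=> c0; rewrite -[RHS](kh c) // mulr1 !mulrA ![c * _]mulrC !mulfK.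
have lnormal (a b c : R) : c != 0 -> lat a b c = (1 + ((a / c) ^+ 2 + (b / c) ^+ 2))^-1.
  move=> c0; have := sqr_ge0 (a / c); have := sqr_ge0 (b / c) => h1 h2.
  have : 0 < sqn a b c by rewrite sqn_gt0 c0 !orbT.
  by rewrite /lat /sqn => h3; field; rewrite c0 /= gt_eqF //=; lra.
have [x'0|r0] := eqVneq (x' ^+ 2 + y' ^+ 2) 0.
  have [/eqP -> /eqP ->] : x' == 0 /\ y' == 0.
    apply/andP; rewrite -(sqrf_eq0 x') -(sqrf_eq0 y').
    by rewrite -paddr_eq0 ?sqr_ge0 // x'0.
  by rewrite (polar_pole kP) //; have := polar_top kP u0; lra.
rewrite (normal x y z) // (normal x' y' z') //.
move: uv; rewrite !lnormal //.
set a := x / z; set b := y / z; set a' := x' / z'; set b' := y' / z' => uv.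
have r'0 : 0 < a' ^+ 2 + b' ^+ 2.
  have -> : a' ^+ 2 + b' ^+ 2 = (x' ^+ 2 + y' ^+ 2) / z' ^+ 2.
    by rewrite !expr_div_n -mulrDl.
  by rewrite divr_gt0 // lt0r ?r0 ?sqrf_eq0 ?z'0 ?addr_ge0 ?sqr_ge0.
have ra0 : 0 <= a ^+ 2 + b ^+ 2 by rewrite addr_ge0 ?sqr_ge0.
have v1 : a' +i* b' != 0.
  by apply: contraTneq r'0 => -[-> ->]; rewrite expr0n addr0 ltxx.
pose c := (a +i* b) / (a' +i* b').
have cE : c * (a' +i* b') = a +i* b by rewrite divfK.
have cn : sqnormc c * (a' ^+ 2 + b' ^+ 2) = a ^+ 2 + b ^+ 2.
  by rewrite -[a' ^+ 2 + _]/(sqnormc (a' +i* b')) -sqnormcM cE.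
have [|t [s cf]] := nP c.
  have d0 : 0 < 1 + (a ^+ 2 + b ^+ 2) by lra.
  have d'0 : 0 < 1 + (a' ^+ 2 + b' ^+ 2) by lra.
  have h : (1 + (a' ^+ 2 + b' ^+ 2)) * (1 + g * (1 + (a ^+ 2 + b ^+ 2)))
      <= 1 + (a ^+ 2 + b ^+ 2).
    have e1 : (1 + (a ^+ 2 + b ^+ 2))^-1 * (1 + (a ^+ 2 + b ^+ 2)) = 1.
      by rewrite mulVf ?gt_eqF.
    have e2 : (1 + (a' ^+ 2 + b' ^+ 2))^-1 * (1 + (a' ^+ 2 + b' ^+ 2)) = 1.
      by rewrite mulVf ?gt_eqF.
    move: (_^-1) (_^-1) e1 e2 uv => i1 i2 e1 e2 uv.
    have := ler_wpM2r (ltW (mulr_gt0 d0 d'0)) uv.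
    by rewrite mulrDl mulrA e1 mul1r [i1 * _]mulrCA e2 mulr1; lra.
  rewrite -(ler_pM2r r'0) cn; move: (a ^+ 2 + b ^+ 2) (a' ^+ 2 + b' ^+ 2) ra0 r'0 h.
  move=> r r' ra0 r'0 h; have : 0 <= g * (r * (1 + r')).
    by apply: mulr_ge0; [exact: ltW | apply: mulr_ge0 => //; lra].
  by nra.
have := planar_spiral kP ((1 +i* s) * (1 +i* - s) * (a' +i* b')) t n.
rewrite mulrA -cf cE -mulrA => h1.
have h2 := planar_step kP ((1 +i* - s) * (a' +i* b')) s.
have h3 := planar_step kP (a' +i* b') (- s).
rewrite -[k a b 1]/(planar k (a +i* b)) -[k a' b' 1]/(planar k (a' +i* b')).
lra.
Qed.

End Frames.

(** * Frame functions with a near-minimum at the pole *)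

Section NearMin.
Variable R : realType.
Implicit Types (f k : R -> R -> R -> R) (x y z W K eps g : R).

(** First [N] is taken so large that the rounding error is at most [eta / 2]; the length [n] of the
    spirals for the corresponding gap then dictates how small [eps] must be. Both depend on [B] and
    [eta] alone. *)
Lemma polar_bound (B eta : R) : 0 <= B -> 0 < eta -> exists2 delta : R, 0 < delta &
  forall K eps k, polar_frame K eps k -> K <= B -> eps <= delta ->
  forall x y z, 0 < sqn x y z -> `|k x y z - K * lat x y z| <= eta.
Proof.
move=> B0 eta0; pose N := (Num.truncn (6 * B / eta)).+1.
have NP : 6 * B / eta < N%:R by exact: truncnS_gt.
have N0 : 0 < N%:R :> R by rewrite ltr0n.
have g0 : 0 < (N%:R * N.+1%:R)^-1 :> R by rewrite invr_gt0 mulr_gt0 // ltr0n.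
have [n nP] := polar_mono g0.
pose C : R := (N%:R + 3) * n.+1%:R.
have C0 : 0 < C by rewrite mulr_gt0 ?ltr0n // addr_gt0 // ltr0n.
exists (eta / 2 / C); first by rewrite !divr_gt0.
move=> K eps k kP KB epsP x y z u0.
have eps0 := polar_eps_ge0 kP; have [_ kp _ _] := kP.
pose T := {u : R * R * R | 0 < sqn u.1.1 u.1.2 u.2}.
pose kT (u : T) : R := k (sval u).1.1 (sval u).1.2 (sval u).2.
pose lT (u : T) : R := lat (sval u).1.1 (sval u).1.2 (sval u).2.
have mk a b c : 0 < sqn a b c -> {u : T | kT u = k a b c /\ lT u = lat a b c}.
  by move=> h; exists (exist (fun u : R * R * R => 0 < sqn u.1.1 u.1.2 u.2) (a, b, c) h).
have p0 : 0 < sqn (0 : R) 0 1 by rewrite /sqn; lra.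
have [u [ku lu]] := mk _ _ _ u0; have [p [kTp lp]] := mk _ _ _ p0.
pose e := n.+1%:R * eps.
have e0 : 0 <= e by rewrite mulr_ge0.
have eE : e = n%:R * eps + eps by rewrite /e -natr1 mulrDl mul1r.
have ne0 : 0 <= n%:R * eps by rewrite mulr_ge0.
have lp1 : lT p = 1 by rewrite lp /lat /sqn expr0n !add0r expr1n divr1.
have Kp : kT p = K by rewrite kTp.
have l01 (v : T) : 0 <= lT v <= 1.
  by case: v => v v0; rewrite /lT /= lat_ge0 // lat_le1.
have := @latitude_bound R T kT lT K B e N p isT KB B0 e0 l01 lp1 Kp _ _ _ _ u.
rewrite ku lu => h; apply: le_trans (h _ _ _ _) _.
- case=> v v0 a b a0 b0 /(polar_split kP v0 a0 b0) [x1 [y1 [z1 [x2 [y2 [z2]]]]]].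
  move=> [/mk [s [ks ls]] /mk [t [kt lt]] la lb kv].
  by exists s, t; rewrite ls lt /kT /= kv -ks -kt.
- case=> v v0; have [x' [y' [z' [/mk [t [kt lt]] l1 k1]]]] := polar_flip kP v0.
  by exists t; rewrite lt l1 kt -k1.
- case=> v v0 [v' v'0] /= h1.
  by have := nP _ _ _ kP _ _ _ _ _ _ v0 v'0 h1; rewrite /kT /= eE; lra.
- by case=> v v0; have := polar_top kP v0; rewrite /kT /= eE; lra.
have h1 : 3 * B / N%:R <= eta / 2.
  rewrite ler_pdivrMr //; move: NP; rewrite ltr_pdivrMr // => NP; lra.
have h2 : (N%:R + 3) * e <= eta / 2.
  by rewrite /e mulrA -/C -ler_pdivlMl // mulrC.
lra.
Qed.

(** Both pairs are orthogonal in the plane of the meridian, and [(- y, x, 0)] completes each to a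
    triple. *)
Lemma frame_meridian W f x y z : frame_function W f -> 0 < x ^+ 2 + y ^+ 2 ->
  f x y z + f (- x * z) (- y * z) (x ^+ 2 + y ^+ 2) = f 0 0 1 + f x y 0.
Proof.
move=> [_ fs] r0.
have u0 : 0 < sqn x y z by rewrite /sqn; have := sqr_ge0 z; lra.
have v0 : 0 < sqn (- x * z) (- y * z) (x ^+ 2 + y ^+ 2).
  by rewrite sqn_gt0 (gt_eqF r0) !orbT.
have n0 : 0 < sqn (- y) x 0 by rewrite /sqn; nra.
have p0 : 0 < sqn (0 : R) 0 1 by rewrite /sqn; lra.
have e0 : 0 < sqn x y 0 by rewrite /sqn; nra.
have h1 := fs _ _ _ _ _ _ _ _ _ u0 v0 n0; have h2 := fs _ _ _ _ _ _ _ _ _ p0 e0 n0.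
by apply: (addIr (f (- y) x 0)); rewrite h1 ?h2 //; ring.
Qed.

Lemma frame_rotate W f : frame_function W f -> frame_function W (fun x y z => f (- y) x z).
Proof.
move=> [fh fs]; split=> [c x y z c0|]; first by rewrite -mulrN fh.
move=> x1 y1 z1 x2 y2 z2 x3 y3 z3 u v w h1 h2 h3.
by apply: fs; move: u v w h1 h2 h3; rewrite /sqn ?sqrrN; lra.
Qed.

(** On the equator [f] plus its quarter turn is [W - f 0 0 1], so [k] vanishes there; two meridian
    relations give [k >= - 2 * f 0 0 1]. Hence [k] is a polar frame with a small error. *)
Lemma frame_near_min (B eta : R) : 0 <= B -> 0 < eta -> exists2 delta : R, 0 < delta &
  forall W f, frame_function W f -> W <= B ->
  (forall x y z, 0 < sqn x y z -> 0 <= f x y z) -> f 0 0 1 <= delta ->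
  forall x y z, 0 < sqn x y z ->
  `|f x y z + f (- y) x z - W * (1 - lat x y z)| <= eta.
Proof.
move=> B0 eta0; have [|d d0 dP] := polar_bound B0 (_ : 0 < eta / 2); first by lra.
(* The first bound keeps the polar error [2 * f 0 0 1] below [d]; the second absorbs the multiples
   of [f 0 0 1] left over when [k] is expanded. *)
exists (Num.min (d / 2) (eta / 4)); first by rewrite lt_min; apply/andP; split; lra.
move=> W f fW WB f0; rewrite le_min => /andP[fd feta] x y z u0.
have p0 : 0 < sqn (0 : R) 0 1 by rewrite /sqn; lra.
have fp0 := f0 _ _ _ p0.
have [fh fs] := fW; have [_ gs] := frame_rotate fW.
have equ a b : 0 < a ^+ 2 + b ^+ 2 -> f a b 0 + f (- b) a 0 + f 0 0 1 = W.
  move=> ab; have e1 : 0 < sqn a b 0 by rewrite /sqn expr0n addr0.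
  have e2 : 0 < sqn (- b) a 0 by rewrite /sqn expr0n addr0 sqrrN addrC.
  by apply: fs => //; ring.
have eqp : f 1 0 0 + f 0 1 0 + f 0 0 1 = W by apply: fs; rewrite /sqn; lra.
have f10 : 0 <= f 1 0 0 by apply: f0; rewrite /sqn; lra.
have f01 : 0 <= f 0 1 0 by apply: f0; rewrite /sqn; lra.
pose k a b c : R := W - f 0 0 1 - (f a b c + f (- b) a c).
have kP : polar_frame (W - 3 * f 0 0 1) (2 * f 0 0 1) k.
  split.
  - split=> [c a1 b1 c1 c0|x1 y1 z1 x2 y2 z2 x3 y3 z3 h1 h2 h3 h4 h5 h6].
      by rewrite /k -mulrN !fh.
    have := fs _ _ _ _ _ _ _ _ _ h1 h2 h3 h4 h5 h6.
    have := gs _ _ _ _ _ _ _ _ _ h1 h2 h3 h4 h5 h6.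
    by rewrite /k => h7 h8; lra.
  - by rewrite /k oppr0; lra.
  - by move=> a b /equ; rewrite /k; lra.
  - move=> a b c v0; rewrite /k.
    have [r0|r0] := eqVneq (a ^+ 2 + b ^+ 2) 0.
      have [/eqP a0 /eqP b0] : a == 0 /\ b == 0.
        apply/andP; rewrite -(sqrf_eq0 a) -(sqrf_eq0 b).
        by rewrite -paddr_eq0 ?sqr_ge0 // r0.
      have c0 : c != 0 by move: v0; rewrite a0 b0 sqn_gt0 !eqxx.
      rewrite a0 b0 oppr0; have := fh c 0 0 1 c0.
      by rewrite !mulr0 mulr1 => ->; lra.
    have {}r0 : 0 < a ^+ 2 + b ^+ 2 by rewrite lt0r r0 addr_ge0 ?sqr_ge0.
    have r1 : 0 < (- b) ^+ 2 + a ^+ 2 by rewrite sqrrN addrC.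
    have h1 := frame_meridian c fW r0; have h2 := frame_meridian c fW r1.
    have h3 : 0 <= f (- a * c) (- b * c) (a ^+ 2 + b ^+ 2).
      by apply: f0; rewrite sqn_gt0 (gt_eqF r0) !orbT.
    have h4 : 0 <= f (- - b * c) (- a * c) ((- b) ^+ 2 + a ^+ 2).
      by apply: f0; rewrite sqn_gt0 (gt_eqF r1) !orbT.
    by have := equ _ _ r0; lra.
have := dP _ _ _ kP _ _ _ _ _ u0.
have l0 := lat_ge0 u0; have l1 := lat_le1 u0.
have K1 : W - 3 * f 0 0 1 <= B by lra.
have K2 : 2 * f 0 0 1 <= d by lra.
move=> /(_ K1 K2); rewrite /k !ler_norml => /andP[h1 h2].
have h3 : 0 <= f 0 0 1 * lat x y z by rewrite mulr_ge0.
have h4 : f 0 0 1 * lat x y z <= f 0 0 1 by rewrite ler_piMr.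
by apply/andP; split; lra.
Qed.

End NearMin.

(** * Quadratic frame functions and changes of orthonormal frame *)

Section Approx.
Variable R : realType.
Implicit Types (f h : R -> R -> R -> R) (x y z W B e : R).

(** The three vectors are the rows of [A] and, divided by their squared lengths, the columns of
    [Bm]. Orthogonality says that [A *m Bm] is the identity; the conclusions are the entries of
    [Bm *m A]. *)
Lemma orthogonal_basis_resolution (x1 y1 z1 x2 y2 z2 x3 y3 z3 : R) :
  0 < sqn x1 y1 z1 -> 0 < sqn x2 y2 z2 -> 0 < sqn x3 y3 z3 ->
  x1 * x2 + y1 * y2 + z1 * z2 = 0 ->
  x1 * x3 + y1 * y3 + z1 * z3 = 0 ->
  x2 * x3 + y2 * y3 + z2 * z3 = 0 ->
  let i1 := (sqn x1 y1 z1)^-1 in let i2 := (sqn x2 y2 z2)^-1 in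
  let i3 := (sqn x3 y3 z3)^-1 in
  [/\ x1 * x1 * i1 + x2 * x2 * i2 + x3 * x3 * i3 = 1,
      y1 * y1 * i1 + y2 * y2 * i2 + y3 * y3 * i3 = 1,
      z1 * z1 * i1 + z2 * z2 * i2 + z3 * z3 * i3 = 1 &
  [/\ x1 * y1 * i1 + x2 * y2 * i2 + x3 * y3 * i3 = 0,
      x1 * z1 * i1 + x2 * z2 * i2 + x3 * z3 * i3 = 0 &
      y1 * z1 * i1 + y2 * z2 * i2 + y3 * z3 * i3 = 0]].
Proof.
move=> n1 n2 n3 o12 o13 o23 i1 i2 i3.
have e1 : sqn x1 y1 z1 * i1 = 1 by rewrite mulfV // gt_eqF.
have e2 : sqn x2 y2 z2 * i2 = 1 by rewrite mulfV // gt_eqF.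
have e3 : sqn x3 y3 z3 * i3 = 1 by rewrite mulfV // gt_eqF.
clearbody i1 i2 i3.
pose s := [:: [:: x1; y1; z1]; [:: x2; y2; z2]; [:: x3; y3; z3]].
pose A : 'M[R]_3 := \matrix_(i, j) nth 0 (nth [::] s i) j.
pose Bm : 'M[R]_3 := \matrix_(i, j) (A j i * nth 0 [:: i1; i2; i3] j).
have AB : A *m Bm = 1%:M.
  apply/matrixP => i j; rewrite !mxE !big_ord_recl big_ord0 !mxE.
  case: i => [[|[|[|//]]] ?]; case: j => [[|[|[|//]]] ?] //=; rewrite /sqn in e1 e2 e3.
  - by rewrite -{}e1; ring.
  - by transitivity ((x1 * x2 + y1 * y2 + z1 * z2) * i2); [ring | rewrite o12 mul0r].
  - by transitivity ((x1 * x3 + y1 * y3 + z1 * z3) * i3); [ring | rewrite o13 mul0r].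
  - by transitivity ((x1 * x2 + y1 * y2 + z1 * z2) * i1); [ring | rewrite o12 mul0r].
  - by rewrite -{}e2; ring.
  - by transitivity ((x2 * x3 + y2 * y3 + z2 * z3) * i3); [ring | rewrite o23 mul0r].
  - by transitivity ((x1 * x3 + y1 * y3 + z1 * z3) * i1); [ring | rewrite o13 mul0r].
  - by transitivity ((x2 * x3 + y2 * y3 + z2 * z3) * i2); [ring | rewrite o23 mul0r].
  - by rewrite -{}e3; ring.
have BA (i j : 'I_3) : \sum_l Bm i l * A l j = (i == j)%:R.
  by have := mulmx1C AB => /matrixP /(_ i j); rewrite !mxE.
pose j0 : 'I_3 := Ordinal (isT : (0 < 3)%N); pose j1 : 'I_3 := Ordinal (isT : (1 < 3)%N).
pose j2 : 'I_3 := Ordinal (isT : (2 < 3)%N).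
have := BA j0 j0; have := BA j1 j1; have := BA j2 j2.
have := BA j0 j1; have := BA j0 j2; have := BA j1 j2.
rewrite !big_ord_recl !big_ord0 !mxE /= => h1 h2 h3 h4 h5 h6.
by split; [..|split]; [rewrite -[RHS]h6|rewrite -[RHS]h5|rewrite -[RHS]h4|rewrite -[RHS]h3
  |rewrite -[RHS]h2|rewrite -[RHS]h1]; ring.
Qed.

Lemma quadratic_frame (a b c : R) : frame_function (a + b + c)
  (fun x y z => (a * x ^+ 2 + b * y ^+ 2 + c * z ^+ 2) / sqn x y z).
Proof.
split=> [t x y z t0|].
  have -> : sqn (t * x) (t * y) (t * z) = t ^+ 2 * sqn x y z by rewrite /sqn; ring.
  have -> : a * (t * x) ^+ 2 + b * (t * y) ^+ 2 + c * (t * z) ^+ 2 =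
    t ^+ 2 * (a * x ^+ 2 + b * y ^+ 2 + c * z ^+ 2) by ring.
  by rewrite -mulf_div divff ?mul1r // sqrf_eq0.
move=> x1 y1 z1 x2 y2 z2 x3 y3 z3 n1 n2 n3 o12 o13 o23.
have [h1 h2 h3 _] := orthogonal_basis_resolution n1 n2 n3 o12 o13 o23.
rewrite -[a in RHS]mulr1 -[b in RHS]mulr1 -[c in RHS]mulr1 -{1}h1 -{1}h2 -{1}h3.
by ring.
Qed.

Lemma frame_lin W V f h (s t : R) : frame_function W f -> frame_function V h ->
  frame_function (s * W + t * V) (fun x y z => s * f x y z + t * h x y z).
Proof.
move=> [fh fs] [hh hs]; split=> [c x y z c0|]; first by rewrite fh ?hh.
move=> x1 y1 z1 x2 y2 z2 x3 y3 z3 n1 n2 n3 o12 o13 o23.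
by rewrite -(fs _ _ _ _ _ _ _ _ _ n1 n2 n3) // -(hs _ _ _ _ _ _ _ _ _ n1 n2 n3) //; ring.
Qed.

Definition orthonormal3 (a1 a2 a3 b1 b2 b3 c1 c2 c3 : R) : Prop :=
  [/\ sqn a1 a2 a3 = 1, sqn b1 b2 b3 = 1, sqn c1 c2 c3 = 1 &
  [/\ a1 * b1 + a2 * b2 + a3 * b3 = 0, a1 * c1 + a2 * c2 + a3 * c3 = 0
    & b1 * c1 + b2 * c2 + b3 * c3 = 0]].

Section ChangeOfFrame.
Variables a1 a2 a3 b1 b2 b3 c1 c2 c3 : R.
Hypothesis o : orthonormal3 a1 a2 a3 b1 b2 b3 c1 c2 c3.

Definition change_frame f : R -> R -> R -> R := fun x y z =>
  f (x * a1 + y * b1 + z * c1) (x * a2 + y * b2 + z * c2) (x * a3 + y * b3 + z * c3).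

Lemma change_frame_dot x y z x' y' z' :
  (x * a1 + y * b1 + z * c1) * (x' * a1 + y' * b1 + z' * c1) +
  (x * a2 + y * b2 + z * c2) * (x' * a2 + y' * b2 + z' * c2) +
  (x * a3 + y * b3 + z * c3) * (x' * a3 + y' * b3 + z' * c3) = x * x' + y * y' + z * z'.
Proof.
have [na nb nc [ab ac bc]] := o.
transitivity (x * x' * sqn a1 a2 a3 + y * y' * sqn b1 b2 b3 + z * z' * sqn c1 c2 c3
  + (x * y' + x' * y) * (a1 * b1 + a2 * b2 + a3 * b3)
  + (x * z' + x' * z) * (a1 * c1 + a2 * c2 + a3 * c3)
  + (y * z' + y' * z) * (b1 * c1 + b2 * c2 + b3 * c3)); first by rewrite /sqn; ring.
by rewrite na nb nc ab ac bc !mulr1 !mulr0 !addr0.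
Qed.

Lemma change_frame_sqn x y z :
  sqn (x * a1 + y * b1 + z * c1) (x * a2 + y * b2 + z * c2) (x * a3 + y * b3 + z * c3)
  = sqn x y z.
Proof. by have := change_frame_dot x y z x y z; rewrite -!expr2. Qed.

Lemma frame_change W f : frame_function W f -> frame_function W (change_frame f).
Proof.
move=> [fh fs]; split=> [t x y z t0|].
  by rewrite -[RHS](fh t) // /change_frame; congr f; ring.
move=> x1 y1 z1 x2 y2 z2 x3 y3 z3 n1 n2 n3 o12 o13 o23.
by apply: fs; rewrite ?change_frame_sqn // change_frame_dot.
Qed.

Lemma change_frame_coord (s1 s2 s3 : R) :
  let x := s1 * a1 + s2 * a2 + s3 * a3 in
  let y := s1 * b1 + s2 * b2 + s3 * b3 in
  let z := s1 * c1 + s2 * c2 + s3 * c3 in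
  [/\ x * a1 + y * b1 + z * c1 = s1, x * a2 + y * b2 + z * c2 = s2
    & x * a3 + y * b3 + z * c3 = s3].
Proof.
have [na nb nc [ab ac bc]] := o.
have [] := @orthogonal_basis_resolution a1 a2 a3 b1 b2 b3 c1 c2 c3.
all: rewrite ?na ?nb ?nc // !invr1 !mulr1 => h1 h2 h3 [h4 h5 h6]; split.
- by transitivity (s1 * (a1 * a1 + b1 * b1 + c1 * c1) + s2 * (a1 * a2 + b1 * b2 + c1 * c2)
    + s3 * (a1 * a3 + b1 * b3 + c1 * c3)); [ring | rewrite h1 h4 h5; ring].
- by transitivity (s1 * (a1 * a2 + b1 * b2 + c1 * c2) + s2 * (a2 * a2 + b2 * b2 + c2 * c2)
    + s3 * (a2 * a3 + b2 * b3 + c2 * c3)); [ring | rewrite h2 h4 h6; ring].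
- by transitivity (s1 * (a1 * a3 + b1 * b3 + c1 * c3) + s2 * (a2 * a3 + b2 * b3 + c2 * c3)
    + s3 * (a3 * a3 + b3 * b3 + c3 * c3)); [ring | rewrite h3 h5 h6; ring].
Qed.

End ChangeOfFrame.

Lemma unit_vector x y z : 0 < sqn x y z -> exists m, m != 0 /\ sqn (m * x) (m * y) (m * z) = 1.
Proof.
move=> n0; exists (Num.sqrt (sqn x y z)^-1); split.
  by rewrite sqrtr_eq0 -ltNge invr_gt0.
have := sqr_sqrtr (_ : 0 <= (sqn x y z)^-1); rewrite invr_ge0 ltW // => /(_ isT).
move: (Num.sqrt _) => m mE; rewrite -[RHS](mulVf (_ : sqn x y z != 0)) ?gt_eqF // -mE.
by rewrite /sqn; ring.
Qed.

(** The line of [p] becomes the third axis and [s] falls into the plane of the first and third: a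
    near-minimum can sit at the pole with a near-maximum on a known meridian. *)
Lemma adapted_frame (p1 p2 p3 s1 s2 s3 : R) : 0 < sqn p1 p2 p3 ->
  exists a1 a2 a3 b1 b2 b3 c1 c2 c3 m x z, [/\ orthonormal3 a1 a2 a3 b1 b2 b3 c1 c2 c3,
    m != 0, [/\ c1 = m * p1, c2 = m * p2 & c3 = m * p3] &
    [/\ s1 = x * a1 + z * c1, s2 = x * a2 + z * c2 & s3 = x * a3 + z * c3]].
Proof.
move=> p0; have [m [m0 cn]] := unit_vector p0.
set c1 := m * p1 in cn *; set c2 := m * p2 in cn *; set c3 := m * p3 in cn *.
have [t1 [t2 [t3 [w [w' [u0 s1E s2E s3E]]]]]] : exists t1 t2 t3 w w' : R,
    [/\ 0 < sqn t1 t2 t3 /\ t1 * c1 + t2 * c2 + t3 * c3 = 0, s1 = w * t1 + w' * c1,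
     s2 = w * t2 + w' * c2 & s3 = w * t3 + w' * c3].
  pose d t1 t2 t3 := t1 * c1 + t2 * c2 + t3 * c3.
  have perp (t1 t2 t3 : R) : (t1 - d t1 t2 t3 * c1) * c1 + (t2 - d t1 t2 t3 * c2) * c2 +
      (t3 - d t1 t2 t3 * c3) * c3 = 0.
    by transitivity (d t1 t2 t3 * (1 - sqn c1 c2 c3)); [rewrite /d /sqn; ring|rewrite cn; ring].
  pose n t1 t2 t3 := sqn (t1 - d t1 t2 t3 * c1) (t2 - d t1 t2 t3 * c2) (t3 - d t1 t2 t3 * c3).
  have n_ge0 t1 t2 t3 : 0 <= n t1 t2 t3 by rewrite /n /sqn !addr_ge0 ?sqr_ge0.
  (* [n] is the squared length of the component orthogonal to [c]. If it vanishes at [s], the first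
     axis comes from a coordinate vector not parallel to [c]. *)
  have [sn|sn] := eqVneq (n s1 s2 s3) 0; last first.
    exists (s1 - d s1 s2 s3 * c1), (s2 - d s1 s2 s3 * c2), (s3 - d s1 s2 s3 * c3).
    exists 1, (d s1 s2 s3); split; [|ring|ring|ring].
    by split=> //; rewrite lt0r sn n_ge0.
  have [/eqP z1 /eqP z2 /eqP z3] : [/\ s1 - d s1 s2 s3 * c1 == 0,
      s2 - d s1 s2 s3 * c2 == 0 & s3 - d s1 s2 s3 * c3 == 0].
    apply/and3P; apply: contra_eqT sn => h; rewrite gt_eqF // sqn_gt0.
    by move: h; rewrite !negb_and.
  have nE t1 t2 t3 : n t1 t2 t3 = sqn t1 t2 t3 - d t1 t2 t3 ^+ 2.
    transitivity (sqn t1 t2 t3 - d t1 t2 t3 ^+ 2 * (2 - sqn c1 c2 c3)).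
      by rewrite /n /d /sqn; ring.
    by rewrite cn; ring.
  have [t1 [t2 [t3 t0]]] : exists t1 t2 t3, 0 < n t1 t2 t3.
    have [h|h] := ltP (c1 ^+ 2) 1.
      by exists 1, 0, 0; rewrite nE /d /sqn; lra.
    exists 0, 1, 0; rewrite nE /d /sqn; move: cn; rewrite /sqn.
    by have := sqr_ge0 c3; lra.
  exists (t1 - d t1 t2 t3 * c1), (t2 - d t1 t2 t3 * c2), (t3 - d t1 t2 t3 * c3).
  by exists 0, (d s1 s2 s3); split; [|lra|lra|lra].
have [u1 tc] := u0.
have [l [l0 an]] := unit_vector u1.
set a1 := l * t1 in an; set a2 := l * t2 in an; set a3 := l * t3 in an.
have ac : a1 * c1 + a2 * c2 + a3 * c3 = 0.
  by transitivity (l * (t1 * c1 + t2 * c2 + t3 * c3)); [rewrite /a1 /a2 /a3; ring|rewrite tc mulr0].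
exists a1, a2, a3, (c2 * a3 - c3 * a2), (c3 * a1 - c1 * a3), (c1 * a2 - c2 * a1), c1, c2, c3.
exists m, (w / l), w'; split=> //.
- split=> //; last by split=> //; ring.
  transitivity (sqn a1 a2 a3 * sqn c1 c2 c3 - (a1 * c1 + a2 * c2 + a3 * c3) ^+ 2).
    by rewrite /sqn; ring.
  by rewrite ac an cn; ring.
- by rewrite s1E s2E s3E /a1 /a2 /a3 !mulrA !divfK.
Qed.

Lemma frame_near_min_at B eta : 0 <= B -> 0 < eta -> exists2 delta : R, 0 < delta &
  forall W f, frame_function W f -> W <= B ->
  (forall x y z, 0 < sqn x y z -> 0 <= f x y z) ->
  forall p1 p2 p3, sqn p1 p2 p3 = 1 -> f p1 p2 p3 <= delta ->
  forall s1 s2 s3, 0 < sqn s1 s2 s3 ->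
  f s1 s2 s3 <= W * (1 - (s1 * p1 + s2 * p2 + s3 * p3) ^+ 2 / sqn s1 s2 s3) + eta.
Proof.
move=> B0 eta0; have [d d0 dP] := frame_near_min B0 eta0.
exists d => // W f fW WB f0 p1 p2 p3 pn fp s1 s2 s3 s0.
have p0 : 0 < sqn p1 p2 p3 by rewrite pn.
have [a1 [a2 [a3 [b1 [b2 [b3 [c1 [c2 [c3 [m [_ [_ [o m0 [c1E c2E c3E] _]]]]]]]]]]]]] :=
  adapted_frame 0 0 0 p0.
have m2 : m ^+ 2 = 1.
  have [_ _ <- _] := o; rewrite c1E c2E c3E.
  by transitivity (m ^+ 2 * sqn p1 p2 p3); [rewrite pn mulr1|rewrite /sqn; ring].
have g0 x y z : 0 < sqn x y z -> 0 <= change_frame a1 a2 a3 b1 b2 b3 c1 c2 c3 f x y z.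
  by move=> h; apply: f0; rewrite change_frame_sqn.
have gp : change_frame a1 a2 a3 b1 b2 b3 c1 c2 c3 f 0 0 1 <= d.
  by rewrite /change_frame !mul0r !add0r !mul1r c1E c2E c3E; case: fW => -> .
have [e1 e2 e3] := change_frame_coord o s1 s2 s3.
set x := s1 * a1 + _ + _ in e1 e2 e3; set y := s1 * b1 + _ + _ in e1 e2 e3.
set z := s1 * c1 + _ + _ in e1 e2 e3.
have sE : sqn s1 s2 s3 = sqn x y z by rewrite -(change_frame_sqn o x y z) e1 e2 e3.
have x0 : 0 < sqn x y z by rewrite -sE.
have x1 : 0 < sqn (- y) x z by move: x0; rewrite /sqn sqrrN [y ^+ 2 + _]addrC.
have cfE : change_frame a1 a2 a3 b1 b2 b3 c1 c2 c3 f x y z = f s1 s2 s3.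
  by rewrite /change_frame e1 e2 e3.
have := dP _ _ (frame_change o fW) WB g0 gp _ _ _ x0; rewrite ler_norml => /andP[_].
have := g0 _ _ _ x1; rewrite cfE /lat -sE.
have -> : z ^+ 2 = (s1 * p1 + s2 * p2 + s3 * p3) ^+ 2.
  by rewrite -[RHS]mul1r -m2 /z c1E c2E c3E; ring.
by move: (change_frame _ _ _ _ _ _ _ _ _ _ _ _ _) => g h1 h2; lra.
Qed.

End Approx.

(** * Frame functions that almost change sign under quarter turns *)

Section Gleason3.
Variable R : realType.
Implicit Types (f h : R -> R -> R -> R) (x y z W B e : R).

Lemma frame_sup f B : (forall x y z, 0 < sqn x y z -> f x y z <= B) ->
  exists M, (forall x y z, 0 < sqn x y z -> f x y z <= M) /\
   forall e, 0 < e -> exists x y z, 0 < sqn x y z /\ M - e <= f x y z.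
Proof.
move=> fB; pose E : set R :=
  [set v | exists x y z, 0 < sqn x y z /\ v = f x y z]%classic.
have E0 : has_sup E.
  split; first by exists (f 1 0 0), 1, 0, 0; split=> //; rewrite /sqn; lra.
  by exists B => _ [x [y [z [h ->]]]]; exact: fB.
exists (sup E); split=> [x y z h|e e0].
  by apply: sup_upper_bound => //; exists x, y, z.
have [_ [x [y [z [h ->]]]] h1] := sup_adherent e0 E0.
by exists x, y, z; split=> //; exact: ltW.
Qed.

(** In terms of the gaps [s] and [t] the sum of squares is at least [2 s^2 + 2 s t + t^2]. Were both
    squared gaps above 1/5, then [s t] would be at least 1/5 and this sum would exceed 1. *)
Lemma two_close_sorted (a b c : R) : 0 <= c -> c <= b -> b <= a ->
  a ^+ 2 + b ^+ 2 + c ^+ 2 = 1 -> (a - b) ^+ 2 <= 1 / 5 \/ (b - c) ^+ 2 <= 1 / 5.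
Proof.
have [s ->] : exists s, b = c + s by exists (b - c); ring.
have [t ->] : exists t, a = c + s + t by exists (a - (c + s)); ring.
move=> c0 s0 t0 n.
have -> : c + s + t - (c + s) = t by ring.
have -> : c + s - c = s by ring.
have [|h1] := leP (t ^+ 2) (1 / 5); first by left.
have [|h2] := leP (s ^+ 2) (1 / 5); first by right.
have h3 : 1 / 5 <= s * t.
  have [h|h] := leP s t.
    by apply: le_trans (_ : s * s <= _); [rewrite -expr2 ltW | nra].
  by apply: le_trans (_ : t * t <= _); [rewrite -expr2 ltW | nra].
have h4 : 0 <= c * (3 * c + 4 * s + 2 * t) by apply: mulr_ge0 => //; lra.
nra.
Qed.

Lemma two_close (x y z : R) : sqn x y z = 1 ->
  [\/ (`|x| - `|y|) ^+ 2 <= 1 / 5, (`|y| - `|z|) ^+ 2 <= 1 / 5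
    | (`|x| - `|z|) ^+ 2 <= 1 / 5].
Proof.
rewrite /sqn -(real_normK (num_real x)) -(real_normK (num_real y)) -(real_normK (num_real z)).
have := normr_ge0 x; have := normr_ge0 y; have := normr_ge0 z.
move: `|x| `|y| `|z| => {x y z} a b c c0 b0 a0 n.
have sw (u v : R) : (u - v) ^+ 2 = (v - u) ^+ 2 by ring.
have n' u v w : u ^+ 2 + v ^+ 2 + w ^+ 2 = a ^+ 2 + b ^+ 2 + c ^+ 2 ->
  u ^+ 2 + v ^+ 2 + w ^+ 2 = 1 by move=> ->.
have [ab|/ltW ab] := leP a b; have [bc|/ltW bc] := leP b c; have [ac|/ltW ac] := leP a c.
- by have [|h|h] := two_close_sorted a0 ab bc;
    [apply: n'; ring | apply: Or32 | apply: Or31]; rewrite sw.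
- by have [|h|h] := two_close_sorted a0 ab bc;
    [apply: n'; ring | apply: Or32 | apply: Or31]; rewrite sw.
- by have [|h|h] := two_close_sorted a0 ac bc;
    [apply: n'; ring | apply: Or32 | apply: Or33; rewrite sw].
- by have [|h|h] := two_close_sorted c0 ac ab;
    [apply: n'; ring | apply: Or31; rewrite sw| apply: Or33].
- by have [|h|h] := two_close_sorted b0 ab ac;
    [apply: n'; ring | apply: Or33; rewrite sw | apply: Or31].
- by have [|h|h] := two_close_sorted b0 bc ac;
    [apply: n'; ring | apply: Or33 | apply: Or32; rewrite sw].
- by have [|h|h] := two_close_sorted c0 bc ab;
    [apply: n'; ring | apply: Or31| apply: Or32].
- by have [|h|h] := two_close_sorted c0 bc ab;
    [apply: n'; ring | apply: Or31| apply: Or32].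
Qed.

Definition on_mirror x y z := [\/ x ^+ 2 = y ^+ 2, y ^+ 2 = z ^+ 2 | x ^+ 2 = z ^+ 2].

(** The mirror point is the orthogonal projection onto a plane [a = t b] with a suitable sign [t].
    Its squared length [1 - (a - t b)^2 / 2] is at least 9/10 and is also the squared cosine of the
    angle to the unit vector. *)
Lemma close_mirror (x y z : R) : sqn x y z = 1 -> exists s1 s2 s3 : R,
  [/\ on_mirror s1 s2 s3, 0 < sqn s1 s2 s3 &
  9 / 10 <= (s1 * x + s2 * y + s3 * z) ^+ 2 / sqn s1 s2 s3].
Proof.
have key (a b c : R) : sqn a b c = 1 -> (`|a| - `|b|) ^+ 2 <= 1 / 5 ->
  exists u v : R, [/\ u ^+ 2 = v ^+ 2, 9 / 10 <= sqn u v c & u * a + v * b + c * c = sqn u v c].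
  move=> n; have [t t2 ->] : exists2 t : R, t ^+ 2 = 1 & (`|a| - `|b|) ^+ 2 = (a - t * b) ^+ 2.
    by have [_|_] := ger0P a; have [_|_] := ger0P b; [exists 1|exists (-1)|exists (-1)|exists 1]; ring.
  move=> h; pose w := (a + t * b) / 2; exists w, (t * w).
  have wE : sqn w (t * w) c = w ^+ 2 + t ^+ 2 * w ^+ 2 + c ^+ 2 by rewrite /sqn [(t * w) ^+ 2]exprMn.
  have w2 : w + w = a + t * b by rewrite /w; field.
  clearbody w.
  have e1 : sqn w (t * w) c = 1 - (a - t * b) ^+ 2 / 2.
    rewrite wE t2 mul1r; transitivity (sqn a b c - (a - t * b) ^+ 2 / 2); last by rewrite n.
    rewrite /sqn.
    transitivity ((a + t * b) ^+ 2 / 2 + c ^+ 2); first by rewrite -w2; field.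
    transitivity (a ^+ 2 / 2 + a * (t * b) + (t ^+ 2 * b ^+ 2) / 2 + c ^+ 2); first by field.
    transitivity (a ^+ 2 / 2 + a * (t * b) + b ^+ 2 - (t ^+ 2 * b ^+ 2) / 2 + c ^+ 2); last by field.
    by rewrite t2; field.
  split; first by rewrite [RHS]exprMn t2 mul1r.
    by rewrite e1; lra.
  rewrite wE t2; transitivity (w * (a + t * b) + c * c); first by ring.
  by rewrite -w2; ring.
have fin (u v w a b c : R) : 9 / 10 <= sqn u v w -> u * a + v * b + w * c = sqn u v w ->
    0 < sqn u v w /\ 9 / 10 <= (u * a + v * b + w * c) ^+ 2 / sqn u v w.
  move=> h ->; have n0 : 0 < sqn u v w by lra.
  by split=> //; rewrite expr2 mulfK ?gt_eqF.
move=> n; have [h|h|h] := two_close n.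
- have [u [v [uv s9 sE]]] := key _ _ _ n h.
  by exists u, v, z; have [? ?] := fin _ _ _ _ _ _ s9 sE; split=> //; apply: Or31.
- have n1 : sqn y z x = 1 by rewrite -n /sqn; ring.
  have [u [v [uv s9 sE]]] := key _ _ _ n1 h.
  have e2 : sqn u v x = sqn x u v by rewrite /sqn; ring.
  rewrite e2 in s9 sE; have {}sE : x * x + u * y + v * z = sqn x u v by rewrite -sE; ring.
  by exists x, u, v; have [? ?] := fin _ _ _ _ _ _ s9 sE; split=> //; apply: Or32.
- have n1 : sqn x z y = 1 by rewrite -n /sqn; ring.
  have [u [v [uv s9 sE]]] := key _ _ _ n1 h.
  have e2 : sqn u v y = sqn u y v by rewrite /sqn; ring.
  rewrite e2 in s9 sE; have {}sE : u * x + y * y + v * z = sqn u y v by rewrite -sE; ring.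
  by exists u, y, v; have [? ?] := fin _ _ _ _ _ _ s9 sE; split=> //; apply: Or33.
Qed.

(* Rotations by pi about the axes almost preserve [h], while quarter turns almost negate it. *)
Lemma small_on_mirrors h e x y z : frame_function 0 h ->
  (forall x y z, 0 < sqn x y z -> `|h x y z + h (- y) x z| <= e) ->
  (forall x y z, 0 < sqn x y z -> `|h x y z + h x (- z) y| <= e) ->
  0 < sqn x y z -> on_mirror x y z -> h x y z <= 5 * e.
Proof.
move=> [hh _] H1 H2.
have ev a b c : h (- a) (- b) (- c) = h a b c.
  by rewrite -[RHS](hh (-1)) ?oppr_eq0 ?oner_eq0 // !mulN1r.
have rot a b c : sqn (- b) a c = sqn a b c by rewrite /sqn; ring.
have rot' a b c : sqn a (- c) b = sqn a b c by rewrite /sqn; ring.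
have S12 a b c : 0 < sqn a b c ->
    h (- a) (- b) c <= h a b c + 2 * e /\ h a b c <= h (- a) (- b) c + 2 * e.
  move=> n; have := H1 _ _ _ n; have := H1 (- b) a c; rewrite rot => /(_ n).
  by rewrite !ler_norml => /andP[? ?] /andP[? ?]; split; lra.
have S23 a b c : 0 < sqn a b c ->
    h a (- b) (- c) <= h a b c + 2 * e /\ h a b c <= h a (- b) (- c) + 2 * e.
  move=> n; have := H2 _ _ _ n; have := H2 a (- c) b; rewrite rot' => /(_ n).
  by rewrite !ler_norml => /andP[? ?] /andP[? ?]; split; lra.
(* The half turn about the first axis and the quarter turn about the third send this line to the
   same line, so [h] is close to its own negative there. *)
have M12 a c : 0 < sqn a a c -> - (3 / 2 * e) <= h a a c <= 3 / 2 * e.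
  move=> n; have := H1 _ _ _ n; have [] := S23 _ _ _ n.
  have := ev (- a) a c; rewrite opprK ler_norml => -> ? ? /andP[? ?].
  by apply/andP; split; lra.
have M12' a c : 0 < sqn a a c -> - (5 / 2 * e) <= h a (- a) c <= 5 / 2 * e.
  move=> n; have n' : 0 < sqn a (- a) c by move: n; rewrite /sqn; lra.
  have := H1 _ _ _ n'; rewrite opprK ler_norml => /andP[? ?].
  by have /andP[? ?] := M12 _ _ n; apply/andP; split; lra.
have M23 a b : 0 < sqn a b b -> - (5 / 2 * e) <= h a b b <= 5 / 2 * e.
  move=> n; have n' : 0 < sqn a (- b) b by move: n; rewrite /sqn; lra.
  have [] := S12 _ _ _ n'; have [] := S23 _ _ _ n; rewrite opprK.
  have := ev a (- b) (- b); rewrite opprK => E.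
  have := H2 _ _ _ n; rewrite ler_norml => /andP[? ?].
  have e1 : h (- a) b b = h a (- b) (- b) by rewrite -ev !opprK.
  by rewrite e1 => ? ? ? ?; apply/andP; split; lra.
have M23' a b : 0 < sqn a b b -> - (7 / 2 * e) <= h a b (- b) <= 7 / 2 * e.
  move=> n; have n' : 0 < sqn a b (- b) by move: n; rewrite /sqn; lra.
  have := H2 _ _ _ n'; rewrite opprK ler_norml => /andP[? ?].
  by have /andP[? ?] := M23 _ _ n; apply/andP; split; lra.
have sq (a b : R) : a ^+ 2 = b ^+ 2 -> b = a \/ b = - a.
  by move/eqP; rewrite eqf_sqr => /orP[/eqP->|/eqP->]; [left | right; rewrite opprK].
have e0 : 0 <= e.
  have n : 0 < sqn (1 : R) 0 0 by rewrite /sqn; lra.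
  by apply: le_trans (H1 _ _ _ n).
move=> n [] /sq [] E; rewrite {}E ?sqrrN in n *.
- by have /andP[] := M12 _ _ n; lra.
- have n' : 0 < sqn x x z by move: n; rewrite /sqn; lra.
  by have /andP[] := M12' _ _ n'; lra.
- by have /andP[] := M23 _ _ n; lra.
- have n' : 0 < sqn x y y by move: n; rewrite /sqn; lra.
  by have /andP[] := M23' _ _ n'; lra.
(* A quarter turn about the third axis leads back to a plane already treated, at the cost of one
   more [e]. *)
- have n' : 0 < sqn (- y) x x by move: n; rewrite /sqn; lra.
  have := H1 _ _ _ n; rewrite ler_norml => /andP[? ?].
  by have /andP[? ?] := M23 _ _ n'; lra.
- have n' : 0 < sqn (- y) x x by move: n; rewrite /sqn; lra.
  have := H1 _ _ _ n; rewrite ler_norml => /andP[? ?].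
  by have /andP[? ?] := M23' _ _ n'; lra.
Qed.

(** [D - h] is nonnegative of weight [3 D], with a near-minimum where [h] is close to its supremum
    [D]. At a mirror point [h <= 5 e], so [D (3 L - 2) <= 6 e] with [L >= 9/10], and [D <= 9 e]. A
    quarter turn converts this into the lower bound [- 10 e]. *)
Lemma alternating_frame_small B eta : 0 <= B -> 0 < eta -> exists2 e : R, 0 < e &
  forall h, frame_function 0 h -> (forall x y z, 0 < sqn x y z -> h x y z <= B) ->
  (forall x y z, 0 < sqn x y z -> `|h x y z + h (- y) x z| <= e) ->
  (forall x y z, 0 < sqn x y z -> `|h x y z + h x (- z) y| <= e) ->
  forall x y z, 0 < sqn x y z -> `|h x y z| <= eta.
Proof.
move=> B0 eta0; pose e := eta / 10.
have e0 : 0 < e by rewrite divr_gt0.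
have B3 : 0 <= 3 * B by lra.
have [d d0 dP] := frame_near_min_at B3 e0.
exists e => // h hF hB H1 H2.
have [D [hD Dh]] := frame_sup hB.
have DB : D <= B.
  apply/ler_addgt0Pr => t t0; have [x [y [z [n ?]]]] := Dh _ t0.
  by have := hB _ _ _ n; lra.
have [p1 [p2 [p3 [pn ph]]]] := Dh _ d0.
have gF : frame_function (D + D + D + -1 * 0) (fun x y z => D - h x y z).
  have := frame_lin 1 (-1) (quadratic_frame D D D) hF.
  rewrite mul1r => -[_ gs]; split=> [c x y z c0|]; first by have [hh _] := hF; rewrite hh.
  move=> x1 y1 z1 x2 y2 z2 x3 y3 z3 n1 n2 n3 o12 o13 o23.
  have [_ hs] := hF; have := hs _ _ _ _ _ _ _ _ _ n1 n2 n3 o12 o13 o23; lra.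
rewrite mulr0 addr0 in gF.
have g0 x y z : 0 < sqn x y z -> 0 <= D - h x y z by move=> /hD; lra.
have [m [m0 mn]] := unit_vector pn.
have [hh _] := hF.
have [s1 [s2 [s3 [sm sn s9]]]] := close_mirror mn.
have hs := small_on_mirrors hF H1 H2 sn sm.
have DD : D + D + D <= 3 * B by lra.
have mh : D - h (m * p1) (m * p2) (m * p3) <= d by rewrite hh //; lra.
have := dP _ _ gF DD g0 _ _ _ mn mh _ _ _ sn.
move: (_ ^+ 2 / _) s9 => L s9 h1.
have [_ hsum] := hF.
have D0 : 0 <= D.
  have n1 : 0 < sqn (1 : R) 0 0 by rewrite /sqn; lra.
  have n2 : 0 < sqn (0 : R) 1 0 by rewrite /sqn; lra.
  have n3 : 0 < sqn (0 : R) 0 1 by rewrite /sqn; lra.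
  have h0 : h 1 0 0 + h 0 1 0 + h 0 0 1 = 0 by apply: hsum => //; ring.
  by have := hD _ _ _ n1; have := hD _ _ _ n2; have := hD _ _ _ n3; lra.
have hL : 0 <= D * (L - 9 / 10) by apply: mulr_ge0 => //; lra.
have eE : e = eta / 10 by [].
clearbody e.
have D9 : D <= 9 * e by lra.
move=> x y z n; have n' : 0 < sqn (- y) x z by move: n; rewrite /sqn; lra.
have := hD _ _ _ n; have := hD _ _ _ n'; have := H1 _ _ _ n.
by rewrite !ler_norml => /andP[? ?] ? ?; apply/andP; split; lra.
Qed.

End Gleason3.

(** * Nonnegative frame functions are quadratic *)

Section Gleason3.
Variable R : realType.
Implicit Types (f h : R -> R -> R -> R) (x y z W B e : R).

Lemma frame_le_weight W f x y z : frame_function W f ->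
  (forall x y z, 0 < sqn x y z -> 0 <= f x y z) -> 0 < sqn x y z -> f x y z <= W.
Proof.
move=> [fh fs] f0 n.
have [a1 [a2 [a3 [b1 [b2 [b3 [c1 [c2 [c3 [m [_ [_ [o m0 [E1 E2 E3] _]]]]]]]]]]]]] :=
  adapted_frame 0 0 0 n.
rewrite -(fh m) // -E1 -E2 -E3.
case: o => na nb nc [ab ac bc].
have pa : 0 < sqn a1 a2 a3 by rewrite na.
have pb : 0 < sqn b1 b2 b3 by rewrite nb.
have pc : 0 < sqn c1 c2 c3 by rewrite nc.
have := fs _ _ _ _ _ _ _ _ _ pa pb pc ab ac bc.
by have := f0 _ _ _ pa; have := f0 _ _ _ pb; lra.
Qed.

Lemma frame_cycle W f : frame_function W f -> frame_function W (fun x y z => f z x y).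
Proof.
move=> [fh fs]; split=> [c x y z c0|]; first by rewrite fh.
move=> x1 y1 z1 x2 y2 z2 x3 y3 z3 u v w h1 h2 h3.
by apply: fs; move: u v w h1 h2 h3; rewrite /sqn; lra.
Qed.

(* The form has eigenvalue [M] at the near-maximum (1,0,0), 0 at the near-minimum
   (0,0,1), and therefore [V - M] at (0,1,0). *)
Lemma frame_diagonal_approx B eta : 0 <= B -> 0 < eta -> exists2 d : R, 0 < d &
  forall V M f, frame_function V f -> V <= B -> M <= B ->
  (forall x y z, 0 < sqn x y z -> 0 <= f x y z <= M) -> f 0 0 1 <= d -> M - f 1 0 0 <= d ->
  forall x y z, 0 < sqn x y z ->
  `|f x y z - (M * x ^+ 2 + (V - M) * y ^+ 2 + 0 * z ^+ 2) / sqn x y z| <= eta.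
Proof.
move=> B0 eta0.
have [|e e0 eP] := alternating_frame_small (_ : 0 <= B + 1) eta0; first by lra.
have [|d d0 dP] := frame_near_min (_ : 0 <= 3 * B) e0; first by lra.
(* The bound 1 on [M - f 1 0 0] yields [V - M >= -1]; then the quadratic form is at least -1 and its
   difference from [f] at most [B + 1]. *)
exists (Num.min d 1); first by rewrite lt_min d0 ltr01.
move=> V M f fF VB MB fM; rewrite !le_min => /andP[fd f1] /andP[Md M1] x y z n.
have [fh fs] := fF.
have n1 : 0 < sqn (1 : R) 0 0 by rewrite /sqn; lra.
have n2 : 0 < sqn (0 : R) 1 0 by rewrite /sqn; lra.
have n3 : 0 < sqn (0 : R) 0 1 by rewrite /sqn; lra.
have sV : f 1 0 0 + f 0 1 0 + f 0 0 1 = V by apply: fs => //; ring.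
have /andP[f10 f1M] := fM _ _ _ n1; have /andP[f20 f2M] := fM _ _ _ n2.
have /andP[f30 f3M] := fM _ _ _ n3.
have hF : frame_function 0
    (fun x y z => 1 * f x y z + -1 * ((M * x ^+ 2 + (V - M) * y ^+ 2 + 0 * z ^+ 2) / sqn x y z)).
  have := frame_lin 1 (-1) fF (quadratic_frame M (V - M) 0).
  by have -> : 1 * V + -1 * (M + (V - M) + 0) = 0 by ring.
have -> : f x y z - (M * x ^+ 2 + (V - M) * y ^+ 2 + 0 * z ^+ 2) / sqn x y z =
   1 * f x y z + -1 * ((M * x ^+ 2 + (V - M) * y ^+ 2 + 0 * z ^+ 2) / sqn x y z) by ring.
apply: (eP _ hF) => // {x y z n} x y z n.
- have /andP[_ h1] := fM _ _ _ n.
  have : -1 <= (M * x ^+ 2 + (V - M) * y ^+ 2 + 0 * z ^+ 2) / sqn x y z.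
    rewrite ler_pdivlMr // /sqn.
    have : 0 <= (M + 1) * x ^+ 2 by rewrite mulr_ge0 ?sqr_ge0 //; lra.
    have : 0 <= (V - M + 1) * y ^+ 2 by rewrite mulr_ge0 ?sqr_ge0 //; lra.
    by have := sqr_ge0 z; lra.
  by lra.
- have V3 : V <= 3 * B by lra.
  have f0 a b c : 0 < sqn a b c -> 0 <= f a b c by move=> /fM /andP[].
  have := dP _ _ fF V3 f0 fd _ _ _ n.
  rewrite (_ : _ - _ * _ = 1 * f x y z - 1 *
     ((M * x ^+ 2 + (V - M) * y ^+ 2 + 0 * z ^+ 2) / sqn x y z) +
    (1 * f (- y) x z - 1 *
     ((M * (- y) ^+ 2 + (V - M) * x ^+ 2 + 0 * z ^+ 2) / sqn (- y) x z))) //.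
    by rewrite !mulN1r !mul1r.
  have -> : sqn (- y) x z = sqn x y z by rewrite /sqn; ring.
  by rewrite /lat; move: n; rewrite /sqn => n; field; rewrite gt_eqF.
have V3 : M + M + M + -1 * V <= 3 * B by lra.
(* Cycling the axes and reversing the sign turns the near-maximum into a near-minimum at the
   pole. *)
have kF : frame_function (M + M + M + -1 * V) (fun x y z => M - f z x y).
  split=> [c x1 y1 z1 c0|]; first by rewrite fh.
  move=> x1 y1 z1 x2 y2 z2 x3 y3 z3 u v w h1 h2 h3.
  by have [_ /(_ _ _ _ _ _ _ _ _ _ u v w h1 h2 h3)] := frame_cycle fF; lra.
have k0 a b c : 0 < sqn a b c -> 0 <= M - f c a b.
  move=> m; have m' : 0 < sqn c a b by move: m; rewrite /sqn; lra.
  by have /andP[] := fM _ _ _ m'; lra.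
have n' : 0 < sqn y z x by move: n; rewrite /sqn; lra.
have := dP _ _ kF V3 k0 Md _ _ _ n'; rewrite -normrN.
rewrite [X in `|X| <= _ -> _](_ : _ = 1 * f x y z - 1 *
   ((M * x ^+ 2 + (V - M) * y ^+ 2 + 0 * z ^+ 2) / sqn x y z) +
  (1 * f x (- z) y - 1 *
   ((M * x ^+ 2 + (V - M) * (- z) ^+ 2 + 0 * y ^+ 2) / sqn x (- z) y))) //.
  by rewrite !mulN1r !mul1r.
have -> : sqn x (- z) y = sqn x y z by rewrite /sqn; ring.
rewrite /lat; have -> : sqn y z x = sqn x y z by rewrite /sqn; ring.
by move: n; rewrite /sqn => n; field; rewrite gt_eqF.
Qed.

(** [S] is minus the infimum of [f], so [g] has infimum 0; [M] is its supremum. A near-maximum need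
    not be orthogonal to the near-minimum, but the meridian relation moves it to the first axis at a
    loss of at most [d / 2]. *)
Lemma frame_quadratic_approx W f eta : frame_function W f ->
  (forall x y z, 0 < sqn x y z -> 0 <= f x y z) -> 0 < eta ->
  exists a1 a2 a3 b1 b2 b3 c1 c2 c3 A1 A2 A3,
  orthonormal3 a1 a2 a3 b1 b2 b3 c1 c2 c3 /\ forall x y z, 0 < sqn x y z ->
  `|change_frame a1 a2 a3 b1 b2 b3 c1 c2 c3 f x y z
    - (A1 * x ^+ 2 + A2 * y ^+ 2 + A3 * z ^+ 2) / sqn x y z| <= eta.
Proof.
move=> fF f0 eta0.
have n1 : 0 < sqn (1 : R) 0 0 by rewrite /sqn; lra.
have W0 : 0 <= W by apply: le_trans (frame_le_weight fF f0 n1); exact: f0.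
have [d d0 dP] := frame_diagonal_approx W0 eta0.
have [|S [fS Sf]] := @frame_sup R (fun x y z => - f x y z) 0.
  by move=> x y z /f0; rewrite oppr_le0.
have S0 : S <= 0.
  apply/ler_addgt0Pr => t t0; have [x [y [z [n ?]]]] := Sf _ t0.
  by have := f0 _ _ _ n; lra.
pose g x y z := S + f x y z.
have gF : frame_function (W + (S + S + S)) g.
  have [fh fs] := fF; split=> [c x1 y1 z1 c0|]; first by rewrite /g fh.
  move=> x1 y1 z1 x2 y2 z2 x3 y3 z3 u v w h1 h2 h3.
  by have := fs _ _ _ _ _ _ _ _ _ u v w h1 h2 h3; rewrite /g; lra.
have g0 x y z : 0 < sqn x y z -> 0 <= g x y z by move=> /fS; rewrite /g; lra.
have [M [gM Mg]] := frame_sup (fun x y z => @frame_le_weight _ g x y z gF g0).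
have d2 : 0 < d / 2 by lra.
have [p1 [p2 [p3 [pn Sp]]]] := Sf _ d2.
have [s1 [s2 [s3 [sn Ms]]]] := Mg _ d2.
have MW : M <= W + (S + S + S).
  apply/ler_addgt0Pr => t t0; have [x [y [z [n ?]]]] := Mg _ t0.
  by have := frame_le_weight gF g0 n; lra.
have [a1 [a2 [a3 [b1 [b2 [b3 [c1 [c2 [c3 [m [u [w [o m0 [c1E c2E c3E] [s1E s2E s3E]]]]]]]]]]]]]] :=
  adapted_frame s1 s2 s3 pn.
pose k := change_frame a1 a2 a3 b1 b2 b3 c1 c2 c3 g.
have kF : frame_function (W + (S + S + S)) k by exact: frame_change o _ _ gF.
have k0 x y z : 0 < sqn x y z -> 0 <= k x y z.
  by move=> h; apply: g0; rewrite (change_frame_sqn o).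
have k0M x y z : 0 < sqn x y z -> 0 <= k x y z <= M.
  by move=> h; rewrite k0 // gM // (change_frame_sqn o).
have kp : k 0 0 1 <= d / 2.
  rewrite /k /change_frame !mul0r !add0r !mul1r c1E c2E c3E.
  by have [-> //] := gF; rewrite /g; lra.
have ks : k u 0 w = g s1 s2 s3 by rewrite /k /change_frame !mul0r !addr0 -s1E -s2E -s3E.
have [kh _] := kF.
have kr : M - k 1 0 0 <= d.
  (* If the near-maximum lies at the pole, then [M <= d] and the first axis is near-maximal as
     well. *)
  have [u0|u0] := eqVneq u 0.
    have n1' := k0 _ _ _ n1.
    have w0 : w != 0.
      apply: contraTneq sn => w0; rewrite s1E s2E s3E u0 w0 !mul0r !addr0.
      by rewrite sqn_gt0 eqxx.
    have := kh w 0 0 1 w0; rewrite !mulr0 mulr1 => E; rewrite u0 E in ks.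
    by lra.
  have r0 : 0 < u ^+ 2 + 0 ^+ 2 by rewrite expr0n addr0 lt0r sqrf_eq0 u0 sqr_ge0.
  have := frame_meridian w kF r0.
  have : 0 <= k (- u * w) (- 0 * w) (u ^+ 2 + 0 ^+ 2).
    by apply: k0; rewrite sqn_gt0 (gt_eqF r0) !orbT.
  have := kh u 1 0 0 u0; rewrite !mulr0 mulr1 => ->.
  by rewrite ks; lra.
exists a1, a2, a3, b1, b2, b3, c1, c2, c3, (M - S), (W + (S + S + S) - M - S), (- S).
split=> // x y z n.
have WS : W + (S + S + S) <= W by lra.
have MW' : M <= W by lra.
have kp' : k 0 0 1 <= d by lra.
have := dP _ _ _ kF WS MW' k0M kp' kr _ _ _ n.
rewrite [X in `|X| <= _ -> _](_ : _ = change_frame a1 a2 a3 b1 b2 b3 c1 c2 c3 f x y z -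
  ((M - S) * x ^+ 2 + (W + (S + S + S) - M - S) * y ^+ 2 + (- S) * z ^+ 2) / sqn x y z) //.
rewrite /k /change_frame /g; move: (f _ _ _) n => v; rewrite /sqn => n.
by field; rewrite gt_eqF.
Qed.

(** A quadratic form on a plane is determined by its values at (1, 0), (0, 1) and (1, 1), which
    dictate [r]. The approximating forms may therefore vary with [eta]: the defect at [(x, y)] is
    bounded by the errors at these points and at [(x, y)], all of order [eta]. *)
Lemma frame_plane_quadratic W f : frame_function W f ->
  (forall x y z, 0 < sqn x y z -> 0 <= f x y z) ->
  exists r, forall x y, f x y 0 * (x ^+ 2 + y ^+ 2)
    = f 1 0 0 * x ^+ 2 + f 0 1 0 * y ^+ 2 + r * (x * y).
Proof.
move=> fF f0; exists (2 * f 1 1 0 - f 1 0 0 - f 0 1 0) => x y.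
have [r0|r0] := eqVneq (x ^+ 2 + y ^+ 2) 0.
  have [/eqP -> /eqP ->] : x == 0 /\ y == 0.
    apply/andP; rewrite -(sqrf_eq0 x) -(sqrf_eq0 y).
    by rewrite -paddr_eq0 ?sqr_ge0 // r0.
  by ring.
have {}r0 : 0 < x ^+ 2 + y ^+ 2 by rewrite lt0r r0 addr_ge0 ?sqr_ge0.
apply/eqP; rewrite -subr_eq0 -normr_eq0 eq_le normr_ge0 andbT.
set E := _ - _.
(* The errors are [eta] at the two axes, [2 * eta] at (1, 1) and [(x ^+ 2 + y ^+ 2) * eta] at
   [(x, y)]. *)
pose C := 2 * (x ^+ 2 + y ^+ 2) + 4 * `|x * y|.
have C0 : 0 <= C by rewrite addr_ge0 ?mulr_ge0 // ltW.
apply/ler_addgt0Pr => t t0; rewrite add0r.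
pose eta := t / (C + 1).
have eta0 : 0 < eta by rewrite divr_gt0 // ltr_wpDl.
have Ct : C * eta <= t.
  have : eta * (C + 1) = t by rewrite divfK // gt_eqF // ltr_wpDl.
  by rewrite mulrDr mulr1 mulrC; lra.
apply: le_trans Ct.
have [a1 [a2 [a3 [b1 [b2 [b3 [c1 [c2 [c3 [A1 [A2 [A3 [o qP]]]]]]]]]]]]] :=
  frame_quadratic_approx fF f0 eta0.
pose q s1 s2 s3 := A1 * (s1 * a1 + s2 * a2 + s3 * a3) ^+ 2
  + A2 * (s1 * b1 + s2 * b2 + s3 * b3) ^+ 2 + A3 * (s1 * c1 + s2 * c2 + s3 * c3) ^+ 2.
have {}qP s1 s2 s3 : 0 < sqn s1 s2 s3 ->
    `|f s1 s2 s3 * sqn s1 s2 s3 - q s1 s2 s3| <= eta * sqn s1 s2 s3.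
  move=> n; have [e1 e2 e3] := change_frame_coord o s1 s2 s3.
  set X := s1 * a1 + _ + _ in e1 e2 e3; set Y := s1 * b1 + _ + _ in e1 e2 e3.
  set Z := s1 * c1 + _ + _ in e1 e2 e3.
  have nE : sqn X Y Z = sqn s1 s2 s3 by rewrite -(change_frame_sqn o X Y Z) e1 e2 e3.
  have nX : 0 < sqn X Y Z by rewrite nE.
  have := qP _ _ _ nX; rewrite /change_frame e1 e2 e3 nE => h.
  have -> : f s1 s2 s3 * sqn s1 s2 s3 - q s1 s2 s3 = (f s1 s2 s3 -
     (A1 * X ^+ 2 + A2 * Y ^+ 2 + A3 * Z ^+ 2) / sqn s1 s2 s3) * sqn s1 s2 s3.
    by rewrite mulrBl divfK ?gt_eqF.
  by rewrite normrM (gtr0_norm n) ler_wpM2r // ltW.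
have n100 : sqn (1 : R) 0 0 = 1 by rewrite /sqn; ring.
have n010 : sqn (0 : R) 1 0 = 1 by rewrite /sqn; ring.
have n110 : sqn (1 : R) 1 0 = 2 by rewrite /sqn; ring.
have nxy : sqn x y 0 = x ^+ 2 + y ^+ 2 by rewrite /sqn; ring.
have := qP 1 0 0; have := qP 0 1 0; have := qP 1 1 0; have := qP x y 0.
rewrite n100 n010 n110 nxy !mulr1 => /(_ r0) h1 /(_ ltac:(lra)) h2 /(_ ltac:(lra)) h3.
move=> /(_ ltac:(lra)) h4.
set u1 := _ - _ in h1; set u2 := _ - _ in h2; set u3 := _ - _ in h3; set u4 := _ - _ in h4.
have EE : E = u1 - x ^+ 2 * u4 - y ^+ 2 * u3 - x * y * (u2 - u4 - u3).
  by rewrite /E /u1 /u2 /u3 /u4 /q; ring.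
have h5 : `|x ^+ 2 * u4| <= x ^+ 2 * eta by rewrite normrM ger0_norm ?sqr_ge0 // ler_wpM2l ?sqr_ge0.
have h6 : `|y ^+ 2 * u3| <= y ^+ 2 * eta by rewrite normrM ger0_norm ?sqr_ge0 // ler_wpM2l ?sqr_ge0.
have h7 : `|x * y * (u2 - u4 - u3)| <= `|x * y| * (4 * eta).
  rewrite normrM ler_wpM2l //; move: h2 h3 h4; rewrite !ler_norml.
  by move=> /andP[? ?] /andP[? ?] /andP[? ?]; apply/andP; split; lra.
rewrite EE /C; move: h1 h5 h6 h7.
move: (x ^+ 2 * u4) (y ^+ 2 * u3) (x * y * _) `|x * y| => v1 v2 v3 v4.
rewrite !ler_norml => /andP[? ?] /andP[? ?] /andP[? ?] /andP[? ?].
by apply/andP; split; lra.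
Qed.

End Gleason3.

(** * Projections and traces *)

Section Hilbert.
Context {R : realType} {H : vectType R[i]} (form : inner_product H).
Implicit Types (u v x y : H) (A P Q : 'End(H)).

Lemma formC u v : form u v = Num.conj (form v u).
Proof. by rewrite hermC expr0 mul1r. Qed.

Lemma formDl u v x : form (u + v) x = form u x + form v x.
Proof. exact: linearDl. Qed.
Lemma formDr u v x : form x (u + v) = form x u + form x v.
Proof. exact: linearDr. Qed.
Lemma formZl a u v : form (a *: u) v = a * form u v.
Proof. exact: linearZl_LR. Qed.
Lemma formZr a u v : form u (a *: v) = Num.conj a * form u v.
Proof. exact: linearZr_LR. Qed.
Lemma form0l u : form 0 u = 0.
Proof. exact: linear0l. Qed.
Lemma form0r u : form u 0 = 0.
Proof. exact: linear0r. Qed.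
Lemma formBl u v x : form (u - v) x = form u x - form v x.
Proof. exact: linearBl. Qed.
Lemma formBr u v x : form x (u - v) = form x u - form x v.
Proof. exact: linearBr. Qed.

Lemma form_inj u v : (forall x, form x u = form x v) -> u = v.
Proof.
move=> h; apply/eqP; rewrite -subr_eq0 -(dnorm_eq0 form).
by rewrite formBr h subrr.
Qed.

Definition outer_fun u v x : H := form x v *: u.

Lemma outer_fun_linear u v : linear (outer_fun u v).
Proof. by move=> a x y; rewrite /outer_fun formDl formZl scalerDl scalerA. Qed.

HB.instance Definition _ u v :=
  GRing.isLinear.Build R[i] H H _ (outer_fun u v) (outer_fun_linear u v).

Definition outer u v : 'End(H) := linfun (outer_fun u v).

Lemma outerE u v x : outer u v x = form x v *: u.
Proof. by rewrite lfunE. Qed.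

Lemma lfun_traceE A :
  lfun_trace A = \sum_i coord (vbasis {:H}) i (A (vbasis {:H})`_i).
Proof.
by apply: eq_bigr => i _; rewrite !mxE /= passmx.vecof_delta.
Qed.

Lemma lfun_traceD A P : lfun_trace (A + P) = lfun_trace A + lfun_trace P.
Proof.
by rewrite !lfun_traceE -big_split; apply: eq_bigr => i _; rewrite add_lfunE linearD.
Qed.

Lemma lfun_trace0 : lfun_trace (0 : 'End(H)) = 0.
Proof. by rewrite lfun_traceE big1 // => i _; rewrite lfunE linear0. Qed.

Lemma trace_outer u v : lfun_trace (outer u v) = form u v.
Proof.
rewrite lfun_traceE [in RHS](coord_vbasis (memvf u)) linear_sumlz.
by apply: eq_bigr => i _; rewrite outerE linearZ /= formZl mulrC.
Qed.

Lemma comp_outer A u v : (A \o outer u v)%VF = outer (A u) v.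
Proof. by apply/lfunP => x; rewrite comp_lfunE !outerE linearZ. Qed.

(** At [v = 0] the inverse is 0 and this is the zero projection. *)
Definition line_proj v : 'End(H) := outer ((form v v)^-1 *: v) v.

Lemma line_projE v x : line_proj v x = (form x v / form v v) *: v.
Proof. by rewrite /line_proj outerE scalerA. Qed.

Lemma line_proj_id v : line_proj v v = v.
Proof.
rewrite line_projE; have [->|v0] := eqVneq v 0; first by rewrite scaler0.
by rewrite divff ?scale1r ?dnorm_eq0.
Qed.

Lemma line_proj_neq0 v : v != 0 -> line_proj v != 0.
Proof. by apply: contraNneq => h; rewrite -[v]line_proj_id h lfunE. Qed.

Lemma line_proj_scale a v : a != 0 -> line_proj (a *: v) = line_proj v.
Proof.
move=> a0; apply/lfunP => x; rewrite !line_projE !formZl !formZr scalerA.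
have [->|v0] := eqVneq v 0; first by rewrite !scaler0.
have f0 : form v v != 0 by rewrite dnorm_eq0.
have a1 : Num.conj a != 0 by rewrite conjC_eq0.
by congr (_ *: _); field; rewrite f0 a0 a1.
Qed.

Lemma conj_dnorm v : Num.conj (form v v) = form v v.
Proof. by rewrite -formC. Qed.

Lemma line_proj_projection v : orthogonal_projection form (line_proj v).
Proof.
split; first by apply/lfunP => x; rewrite comp_lfunE /= [line_proj v x]line_projE linearZ /= line_proj_id.
move=> x y; rewrite !line_projE formZl formZr rmorphM fmorphV /= conj_dnorm -(formC v y).
by ring.
Qed.

Lemma comp_line_proj A v : (A \o line_proj v)%VF = outer ((form v v)^-1 *: A v) v.
Proof. by rewrite /line_proj comp_outer linearZ. Qed.

Lemma trace_comp_line_proj A v : lfun_trace (A \o line_proj v)%VF = form (A v) v / form v v.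
Proof. by rewrite comp_line_proj trace_outer formZl mulrC. Qed.

Lemma line_proj_orth u v : form u v = 0 -> (line_proj u \o line_proj v)%VF = 0.
Proof.
move=> h; have h' : form v u = 0 by rewrite formC h conjC0.
by apply/lfunP => x; rewrite comp_lfunE [line_proj v x]line_projE linearZ /=
  line_projE h' mul0r scale0r scaler0 lfunE.
Qed.

Lemma projK P x : orthogonal_projection form P -> P (P x) = P x.
Proof. by move=> [PP _]; rewrite -comp_lfunE PP. Qed.

Lemma orth_sym P Q : orthogonal_projection form P -> orthogonal_projection form Q ->
  (P \o Q)%VF = 0 -> (Q \o P)%VF = 0.
Proof.
move=> [_ sP] [_ sQ] PQ; apply/lfunP => x; apply: form_inj => y.
rewrite comp_lfunE lfunE /= form0r -sQ -sP -comp_lfunE PQ lfunE /= form0l //.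
Qed.

Lemma projD P Q : orthogonal_projection form P -> orthogonal_projection form Q ->
  (P \o Q)%VF = 0 -> orthogonal_projection form (P + Q).
Proof.
move=> pP pQ PQ; have QP := orth_sym pP pQ PQ; have [PP sP] := pP; have [QQ sQ] := pQ.
split; first by rewrite comp_lfunDl !comp_lfunDr PP PQ QP QQ addr0 add0r.
by move=> u v; rewrite !add_lfunE formDl formDr sP sQ.
Qed.

Lemma projC P : orthogonal_projection form P -> orthogonal_projection form (\1%VF - P).
Proof.
move=> [PP sP]; split.
  rewrite -[_ - _]/(_ + _) comp_lfunDl !comp_lfunDr !comp_lfun1l !comp_lfun1r.
  rewrite comp_lfunNl comp_lfunNr PP.
  by rewrite opprK addNr addr0.
move=> u v; rewrite !add_lfunE !opp_lfunE !id_lfunE.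
by rewrite formBl formBr sP.
Qed.

Lemma projC_orth P : orthogonal_projection form P -> (P \o (\1%VF - P))%VF = 0.
Proof. by move=> [PP _]; rewrite comp_lfunDr comp_lfunNr comp_lfun1r PP subrr. Qed.

Lemma proj1 : orthogonal_projection form \1%VF.
Proof. by split; [rewrite comp_lfun1l | move=> u v; rewrite !id_lfunE]. Qed.

(** Peels one line off the image of [P]; the drop in dimension drives the induction on rank in the
    trace formula. *)
Lemma proj_split P v : orthogonal_projection form P -> P v = v -> v != 0 ->
  [/\ orthogonal_projection form (P - line_proj v), (line_proj v \o (P - line_proj v))%VF = 0
    & (\dim (limg (P - line_proj v)%R) < \dim (limg P))%N].
Proof.
move=> pP Pv v0; have [PP sP] := pP; have [vv sv] := line_proj_projection v.
have Ppr : (P \o line_proj v)%VF = line_proj v.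
  by apply/lfunP => x; rewrite comp_lfunE [line_proj v x]line_projE linearZ /= Pv.
have prP : (line_proj v \o P)%VF = line_proj v.
  by apply/lfunP => x; rewrite comp_lfunE !line_projE sP Pv.
have o : (line_proj v \o (P - line_proj v))%VF = 0 by rewrite comp_lfunDr comp_lfunNr prP vv subrr.
split=> //.
  split; last by move=> x y; rewrite !add_lfunE !opp_lfunE formBl formBr sP sv.
  rewrite -[P - _]/(P + - _) comp_lfunDl !comp_lfunDr !comp_lfunNl !comp_lfunNr.
  by rewrite PP Ppr prP vv opprK addNr addr0.
rewrite ltn_neqAle; apply/andP; split; last first.
  apply: dimvS; apply/subvP => _ /memv_imgP [x _ ->].
  rewrite add_lfunE opp_lfunE -[line_proj v]Ppr comp_lfunE -linearB /=.
  by apply: memv_img; rewrite memvf.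
apply/eqP => e; have sub : (limg (P - line_proj v) <= limg P)%VS.
  apply/subvP => _ /memv_imgP [x _ ->].
  rewrite add_lfunE opp_lfunE -[line_proj v]Ppr comp_lfunE -linearB /=.
  by apply: memv_img; rewrite memvf.
have {}e : limg (P - line_proj v) = limg P by apply/eqP; rewrite eqEdim sub e /=.
have : v \in limg (P - line_proj v) by rewrite e -[v]Pv memv_img ?memvf.
move=> /memv_imgP [x _ E]; have : line_proj v ((P - line_proj v) x) = v by rewrite -E line_proj_id.
by rewrite -comp_lfunE o lfunE /= => /esym/eqP; rewrite (negPf v0).
Qed.

Lemma proj_fixed P : P != 0 -> orthogonal_projection form P -> exists2 v, v != 0 & P v = v.
Proof.
move=> P0 pP; have : exists x, P x != 0.
  apply: contrapT => /forallNP h; move/eqP: P0; apply.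
  by apply/lfunP => x; rewrite [RHS]lfunE; apply/eqP/negPn/negP.
by move=> [x Px]; exists (P x) => //; apply: projK.
Qed.

End Hilbert.

(** * Measurements *)

Section SplitTwo.
Variables (K : choiceType).
Implicit Types (M : {fset K}).

Lemma fset_split2 M Q1 Q2 : Q1 \in M -> Q2 \in M -> Q1 != Q2 -> exists M2,
  (forall X, (X \in M2) = [&& X != Q2, X != Q1 & X \in M]) /\
  forall (V : nmodType) (F : K -> V),
    \sum_(X <- M) F X = F Q1 + (F Q2 + \sum_(X <- M2) F X).
Proof.
move=> Q1M Q2M Q12; have Q2M1 : Q2 \in M `\ Q1 by rewrite in_fsetD1 eq_sym Q12.
exists (M `\ Q1 `\ Q2); split; first by move=> X; rewrite !in_fsetD1.
by move=> V F; rewrite (big_fsetD1 Q1 Q1M) (big_fsetD1 Q2 Q2M1).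
Qed.

Lemma card_fset_split2 M (M2 : {fset K}) Q1 Q2 : Q1 \in M -> Q2 \in M -> Q1 != Q2 ->
  (forall X, (X \in M2) = [&& X != Q2, X != Q1 & X \in M]) -> #|` M| = #|` M2|.+2.
Proof.
move=> Q1M Q2M Q12 M2E; have Q2M1 : Q2 \in M `\ Q1 by rewrite in_fsetD1 eq_sym Q12.
have -> : M2 = M `\ Q1 `\ Q2 by apply/fsetP => X; rewrite M2E !in_fsetD1.
by rewrite (cardfsD1 Q1 M) Q1M (cardfsD1 Q2 (M `\ Q1)) Q2M1.
Qed.

Lemma fset_split2_merge M (M2 : {fset K}) Q Q1 Q2 : Q1 \in M -> Q2 \in M -> Q \notin M2 ->
  (forall X, (X \in M2) = [&& X != Q2, X != Q1 & X \in M]) ->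
  M = (Q |` M2) `\ Q `|` [fset Q1; Q2].
Proof.
move=> Q1M Q2M QM2 M2E; apply/fsetP => X.
rewrite in_fsetU in_fsetD1 in_fset1U M2E in_fset2.
have [->|X1] := eqVneq X Q1; first by rewrite Q1M orbT.
have [->|X2] := eqVneq X Q2; first by rewrite Q2M !orbT.
rewrite /= orbF; have [XQ|XQ] := eqVneq X Q; last by [].
by move: QM2; rewrite M2E -XQ X1 X2 /= => /negPf ->.
Qed.

End SplitTwo.

Section Measurements.
Context {R : realType} {H : vectType R[i]} (form : inner_product H).
Implicit Types (u v x y : H) (A P Q : 'End(H)) (M N : measurement form).

Lemma measurement_inj M N : outcomes M = outcomes N -> M = N.
Proof.
case: M N => M hM [N hN] /= E; case: N / E hN => hN.
by congr Measurement; exact: Prop_irrelevance.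
Qed.

Lemma weight_eq (w : prob_assignment form) M N P
    (PM : P \in outcomes M) (PN : P \in outcomes N) :
  M = N -> w M [` PM] = w N [` PN].
Proof. by move=> E; subst N; congr (w _ [` _]); exact: bool_irrelevance. Qed.

Definition comp0 P Q := (P \o Q)%VF == 0.

Lemma pairwise_comp0 (s : seq 'End(H)) P Q :
  {in s, forall P, orthogonal_projection form P} -> pairwise comp0 s ->
  P \in s -> Q \in s -> P != Q -> (P \o Q)%VF = 0.
Proof.
elim: s P Q => // A s IH P Q pS; rewrite pairwise_cons => /andP[/allP Ax sx].
have pA : orthogonal_projection form A by apply: pS; rewrite mem_head.
have pS' : {in s, forall P, orthogonal_projection form P}.
  by move=> B Bs; apply: pS; rewrite in_cons Bs orbT.
rewrite !in_cons => /orP[/eqP->|Ps] /orP[/eqP->|Qs]; rewrite ?eqxx // => PQ.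
- by apply/eqP/Ax.
- apply: (orth_sym (form := form)) => //; first by apply: pS; rewrite in_cons Ps orbT.
  exact/eqP/Ax.
- exact: IH.
Qed.

(** Zero operators may occur in the list and are dropped, which spares the case of a zero
    complement. A nonzero projection occurs only once, not being orthogonal to itself. *)
Lemma measurement_of_seq (s : seq 'End(H)) :
  {in s, forall P, orthogonal_projection form P} -> pairwise comp0 s ->
  \sum_(P <- s) P = \1%VF -> exists M,
  (forall P, (P \in outcomes M) = (P \in s) && (P != 0)) /\
  forall (F : 'End(H) -> R), F 0 = 0 -> \sum_(P : M) F (val P) = \sum_(P <- s) F P.
Proof.
move=> pS oS sS; pose s' := [seq P <- s | P != 0].
have us' : uniq s'.
  have : pairwise comp0 s' by apply: subseq_pairwise oS; exact: filter_subseq.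
  have : {in s', forall P, P != 0 /\ (P \o P)%VF = P}.
    by move=> P; rewrite mem_filter => /andP[P0 /pS[]].
  elim: s' => // A t IH pt; rewrite pairwise_cons => /andP[/allP At tt] /=.
  rewrite IH // ?andbT; last by move=> B Bt; apply: pt; rewrite in_cons Bt orbT.
  apply/negP => /At /eqP; have [|A0 ->] := pt A; first exact: mem_head.
  by move/eqP; rewrite (negPf A0).
pose M := seq_fset tt s'.
have ME P : (P \in M) = (P \in s) && (P != 0).
  by rewrite seq_fsetE mem_filter andbC.
have sumM (V : nmodType) (F : 'End(H) -> V) : F 0 = 0 ->
    \sum_(P <- M) F P = \sum_(P <- s) F P.
  move=> F0; rewrite (perm_big _ (seq_fset_perm tt s')) /= undup_id //.
  rewrite big_filter big_mkcond; apply: eq_bigr => P _.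
  by case: eqP => // ->.
have pM : projective_measurement form M.
  split.
  - by move=> P; rewrite ME => /andP[/pS].
  - move=> P Q; rewrite !ME => /andP[Ps _] /andP[Qs _].
    exact: pairwise_comp0 Ps Qs.
  - by rewrite sumM.
exists (Measurement pM); split=> // F F0.
by rewrite -(sumM _ F F0) [RHS]big_seq_fsetE.
Qed.

Lemma binary_measurement P : orthogonal_projection form P ->
  exists M, forall Q, (Q \in outcomes M) = (Q \in [:: P; \1%VF - P]) && (Q != 0).
Proof.
move=> pP; have [||| M [ME _]] := @measurement_of_seq [:: P; \1%VF - P].
- by move=> Q; rewrite !inE => /orP[/eqP->|/eqP->] //; apply: projC.
- by rewrite /= !andbT; apply/eqP/(projC_orth (form := form)).
- by rewrite !big_cons big_nil addr0 addrC subrK.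
by exists M.
Qed.

Lemma merge_outcomes M P Q1 Q2 : P \in outcomes M -> Q1 \in outcomes M ->
  Q2 \in outcomes M -> P != Q1 -> P != Q2 -> Q1 != Q2 ->
  exists M', [/\ P \in outcomes M', refines_keeping P M M'
    & (#|` outcomes M'| < #|` outcomes M|)%N].
Proof.
case: M => M hM /=; have [pM oM sM] := hM => PM Q1M Q2M P1 P2 Q12.
have [Q10 pQ1] := pM _ Q1M; have [Q20 pQ2] := pM _ Q2M.
have o12 := oM _ _ Q1M Q2M Q12.
have o21 : (Q2 \o Q1)%VF = 0 by apply: oM => //; rewrite eq_sym.
have [M2 [M2E cM]] := fset_split2 Q1M Q2M Q12.
have {}sM : Q1 + (Q2 + \sum_(X <- M2) X) = \1%VF by apply: etrans sM; apply/esym/cM.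
have [Q QE] : exists Q, Q = Q1 + Q2 by exists (Q1 + Q2).
(* This shows both that [Q] is nonzero and that it is not among the remaining outcomes, which are
   orthogonal to [Q1]. *)
have QQ1 : (Q \o Q1)%VF = Q1 by rewrite QE comp_lfunDl o21 addr0; case: pQ1.
have Q0 : Q != 0.
  by apply: contraNneq Q10 => Q0; rewrite -QQ1 Q0 comp_lfun0l.
have QM2 : Q \notin M2.
  apply: contra Q10; rewrite M2E => /and3P[_ Qn1 QM].
  by rewrite -QQ1 (oM _ _ QM Q1M Qn1).
have pQ : orthogonal_projection form Q by rewrite QE; exact: projD.
have pM' : projective_measurement form (Q |` M2).
  split.
  - move=> X; rewrite in_fset1U M2E => /orP[/eqP->//|/and3P[_ _ /pM//]].
  - have oQ X : X \in M2 -> (X \o Q)%VF = 0.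
      by rewrite M2E => /and3P[X2 X1 XM]; rewrite QE comp_lfunDr !oM // addr0.
    have pX X : X \in M2 -> orthogonal_projection form X.
      by rewrite M2E => /and3P[_ _ /pM[]].
    move=> X Y; rewrite !in_fset1U => /orP[/eqP->|XM] /orP[/eqP->|YM]; rewrite ?eqxx // => XY.
    + by apply: (orth_sym (form := form)); [exact: pX | | exact: oQ].
    + exact: oQ.
    + by move: XM YM; rewrite !M2E => /and3P[_ _ XM] /and3P[_ _ YM]; exact: oM.
  - by rewrite (@big_fsetU1 _ _ _ _ _ _ (fun X => X) QM2) /= QE -addrA.
exists (Measurement pM').
have PM2 : P \in M2 by rewrite M2E P1 P2 PM.
have PQ : P != Q by apply: contraNneq QM2 => <-.
split=> /=.
- by rewrite in_fset1U PM2 orbT.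
- exists Q; last by rewrite /= in_fsetD1 PQ in_fset1U PM2 orbT.
  split; first by rewrite /= fset1U1.
  by exists Q1, Q2; split=> //; exact: fset_split2_merge.
- by rewrite cardfsU1 QM2 (card_fset_split2 Q1M Q2M Q12 M2E).
Qed.

(** Induction on the number of outcomes: two outcomes other than [P] can be merged, and with at most
    one left the sum forces [M] to be [N]. *)
Lemma refinement_consistent_binary (w : prob_assignment form) M N P
    (PM : P \in outcomes M) (PN : P \in outcomes N) :
  refinement_consistent w ->
  (forall Q, (Q \in outcomes N) = (Q \in [:: P; \1%VF - P]) && (Q != 0)) ->
  w M [` PM] = w N [` PN].
Proof.
move=> rc NE; have [n] := ubnP #|` outcomes M|; elim: n M PM => // n IH M PM.
rewrite ltnS => Mn; have [pM oM sM] := measurementP M.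
suff [MN|[Q1 [Q2 [Q1M Q2M P1 P2 Q12]]]] : outcomes M = outcomes N \/
    exists Q1 Q2, [/\ Q1 \in outcomes M, Q2 \in outcomes M, P != Q1, P != Q2 & Q1 != Q2].
- exact/weight_eq/measurement_inj.
- have [M' [PM' ref lt]] := merge_outcomes PM Q1M Q2M P1 P2 Q12.
  by rewrite (rc _ _ _ PM' PM ref); apply: IH; exact: leq_trans lt Mn.
rewrite (big_fsetD1 P) //= in sM; have [P0 _] := pM _ PM.
have [M0|[Q1]] := fset_0Vmem (outcomes M `\ P).
  left; apply/fsetP => X; rewrite NE in_cons mem_seq1.
  move: sM; rewrite M0 big_seq_fset0 addr0 => <-; rewrite subrr.
  have := in_fset0 X; rewrite -M0 in_fsetD1.
  have [->|XP] := eqVneq X P; first by rewrite PM P0.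
  by move=> /= ->; case: eqP.
rewrite in_fsetD1 => /andP[Q1P Q1M].
have Q1MP : Q1 \in outcomes M `\ P by rewrite in_fsetD1 Q1P.
have [M0|[Q2]] := fset_0Vmem (outcomes M `\ P `\ Q1); last first.
  rewrite !in_fsetD1 => /and3P[Q21 Q2P Q2M]; right; exists Q1, Q2.
  by split=> //; rewrite eq_sym.
left; apply/fsetP => X; rewrite NE in_cons mem_seq1.
move: sM; rewrite (big_fsetD1 Q1) // M0 big_seq_fset0 /= addr0 => <-.
have -> : P + Q1 - P = Q1 by rewrite addrC addKr.
have := in_fset0 X; rewrite -M0 !in_fsetD1.
have [->|XP] := eqVneq X P; first by rewrite PM P0.
have [->|XQ] := eqVneq X Q1; first by rewrite Q1M; have [-> _] := pM _ Q1M.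
by move=> /= ->.
Qed.

Lemma refinement_context (w : prob_assignment form) :
  refinement_consistent w -> context_independent w.
Proof.
move=> rc M N P PM PN; have [pM _ _] := measurementP M; have [P0 pP] := pM _ PM.
have [B BE] := binary_measurement pP.
have PB : P \in outcomes B by rewrite BE mem_head P0.
by rewrite (refinement_consistent_binary PM PB) // (refinement_consistent_binary PN PB).
Qed.

Lemma context_independent_measure (w : prob_assignment form) : context_independent w ->
  exists mu : 'End(H) -> R, [/\ mu 0 = 0,
   forall M P (PM : P \in outcomes M), w M [` PM] = mu P,
   forall P, orthogonal_projection form P -> 0 <= mu P,
   mu \1%VF = 1 &
   forall P Q, orthogonal_projection form P -> orthogonal_projection form Q ->
     (P \o Q)%VF = 0 -> mu (P + Q) = mu P + mu Q].
Proof.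
move=> ci.
(* An operator that is an outcome of no measurement, such as 0, gets the default value 0. *)
have val_ex P : exists x : R, (P = 0 -> x = 0) /\
    forall M (PM : P \in outcomes M), w M [` PM] = x.
  have [[M [PM _]]|nM] := pselect (exists M (PM : P \in outcomes M), True).
    exists (w M [` PM]); split; last by move=> N PN; exact: ci.
    by move=> P0; have [pM _ _] := measurementP M; have [/eqP] := pM _ PM.
  by exists 0; split=> // M PM; case: nM; exists M, PM.
have [mu muP] := boolp.choice val_ex.
have mu0 : mu 0 = 0 by have [->] := muP 0.
have muM M P (PM : P \in outcomes M) : w M [` PM] = mu P by have [_ ->] := muP P.
have mu_sum s : {in s, forall P, orthogonal_projection form P} -> pairwise comp0 s ->
    \sum_(P <- s) P = \1%VF -> \sum_(P <- s) mu P = 1.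
  move=> h1 h2 h3; have [M [_ MF]] := measurement_of_seq h1 h2 h3.
  rewrite -MF // -[RHS](weight_sum w M); apply: eq_bigr => P _.
  by rewrite -(muM M (val P) (valP P)); congr (w _ _); exact: val_inj.
have mu2 P : orthogonal_projection form P -> mu P + mu (\1%VF - P) = 1.
  move=> pP; have := mu_sum [:: P; \1%VF - P]; rewrite !big_cons !big_nil !addr0; apply.
  - by move=> Q; rewrite !inE => /orP[/eqP->|/eqP->] //; apply: projC.
  - by rewrite /= !andbT; apply/eqP/(projC_orth (form := form)).
  - by rewrite addrC subrK.
exists mu; split=> //.
- move=> P pP; have [->|P0] := eqVneq P 0; first by rewrite mu0.
  have [M ME] := binary_measurement pP.
  have PM : P \in outcomes M by rewrite ME mem_head P0.
  by rewrite -(muM _ _ PM); have /andP[] := weight_range w [` PM].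
- by have := mu2 _ (proj1 form); rewrite subrr mu0 addr0.
move=> P Q pP pQ PQ; have pD := projD pP pQ PQ.
(* Additivity follows by comparison with the list of [P + Q] and its complement, which has the same
   last entry. *)
have := mu_sum [:: P; Q; \1%VF - (P + Q)]; rewrite !big_cons !big_nil !addr0 => h.
have {}h : mu P + (mu Q + mu (\1%VF - (P + Q))) = 1.
  apply: h.
  - by move=> X; rewrite !in_cons in_nil orbF => /or3P[] /eqP-> //; apply: projC.
  - have QP := orth_sym pP pQ PQ; have [PP _] := pP; have [QQ _] := pQ.
    rewrite /= !andbT /comp0 PQ eqxx /=; apply/andP; split.
      by rewrite comp_lfunDr comp_lfunNr comp_lfun1r comp_lfunDr PP PQ addr0 subrr.
    by rewrite comp_lfunDr comp_lfunNr comp_lfun1r comp_lfunDr QQ QP add0r subrr.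
  - by rewrite addrA addrC subrK.
by have := mu2 _ pD; lra.
Qed.

End Measurements.

(** * The quadratic form of a measure on projections *)

Section Basis.
Context {R : realType} {H : vectType R[i]} (form : inner_product H).
Implicit Types (u v x y : H) (A P Q : 'End(H)).

Definition sqnorm v : R := complex.Re (form v v).

Lemma form_sqnorm v : form v v = (sqnorm v)%:C.
Proof.
have := conj_dnorm form v; rewrite /sqnorm; case: (form v v) => a b /= [] E.
by congr (_ +i* _); lra.
Qed.

Lemma sqnorm_gt0 v : (0 < sqnorm v) = (v != 0).
Proof. by rewrite -(dnorm_gt0 form) form_sqnorm ltcR. Qed.

Lemma conj_real (a : R) : Num.conj a%:C = a%:C.
Proof. exact: conjc_real. Qed.

Lemma normalize v : v != 0 -> exists2 c : R[i], c != 0 & form (c *: v) (c *: v) = 1.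
Proof.
rewrite -sqnorm_gt0 => v0; pose c := Num.sqrt (sqnorm v)^-1.
have c2 : c ^+ 2 = (sqnorm v)^-1 by rewrite sqr_sqrtr // invr_ge0 ltW.
exists c%:C; first by rewrite fmorph_eq0 sqrtr_eq0 -ltNge invr_gt0.
rewrite formZl formZr conj_real form_sqnorm mulrA -!rmorphM -expr2 c2 mulVf ?gt_eqF //.
Qed.

Lemma residual_orth s u x : orthonormal form s -> x \in s ->
  form (u - \sum_(e <- s) form u e *: e) x = 0.
Proof.
move=> /orthonormalP [us os] xs; rewrite formBl linear_sumlz (bigD1_seq x) //=.
rewrite formZl (os x x) // eqxx mulr1 big_seq_cond big1 ?addr0 ?subrr // => e /andP[es ex].
by rewrite formZl (os e x) // (negPf ex) mulr0.
Qed.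

(** The new vector is the normalized residual of [u] or, when that vanishes, of some vector outside
    the span of [s], with [c = 0]. *)
Lemma orthonormal_extend s u : orthonormal form s -> (size s < \dim {:H})%N ->
  exists e c, orthonormal form (e :: s) /\ u = c *: e + \sum_(x <- s) form u x *: x.
Proof.
move=> os ss; pose res t := t - \sum_(x <- s) form t x *: x.
have [t [t0 tP]] : exists t, res t != 0 /\ (res u = res t \/ res u = 0).
  have [u0|u0] := eqVneq (res u) 0; last by exists u; split=> //; left.
  suff : exists t, res t != 0 by move=> [t t0]; exists t; split=> //; right.
  apply: contrapT => /forallNP h.
  have : (fullv <= <<s>>)%VS.
    apply/subvP => t _; have /negP := h t; rewrite negbK subr_eq0 => /eqP ->.
    by rewrite big_seq; apply: memv_suml => x xs; rewrite memvZ // memv_span.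
  by move/dimvS/leq_trans/(_ (dim_span s)); rewrite leqNgt ss.
have [c c0 e1] := normalize t0; exists (c *: res t).
have oe : orthonormal form (c *: res t :: s).
  have /andP[n1 n2] := os; rewrite /orthonormal /= e1 eqxx n1 n2 /= !andbT.
  by apply/allP => x xs /=; rewrite formZl residual_orth ?mulr0.
case: tP => tP.
  exists c^-1; split=> //; rewrite scalerA mulVf // scale1r -tP /res subrK //.
exists 0; split=> //; rewrite scale0r add0r; apply/eqP.
by rewrite -subr_eq0; apply/eqP.
Qed.

Lemma orthonormal_basis : exists s, orthonormal form s /\
  forall u, u = \sum_(e <- s) form u e *: e.
Proof.
have [s [os ss]] : exists s, orthonormal form s /\ size s = \dim {:H}.
  have : forall n, (n <= \dim {:H})%N -> exists s, orthonormal form s /\ size s = n.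
    elim=> [_|n IH nd]; first by exists [::].
    have [s [os sn]] := IH (ltnW nd); have ss : (size s < \dim {:H})%N by rewrite sn.
    by have [e [_ [oe _]]] := orthonormal_extend 0 os ss; exists (e :: s); rewrite /= sn.
  by apply.
exists s; split=> // u; apply/eqP; rewrite -subr_eq0; apply/negPn/negP => t0.
have [c c0 e1] := normalize t0.
have oe : orthonormal form (c *: (u - \sum_(e <- s) form u e *: e) :: s).
  have /andP[n1 n2] := os; rewrite /orthonormal /= e1 eqxx n1 n2 /= !andbT.
  by apply/allP => x xs /=; rewrite formZl residual_orth ?mulr0.
have /eqP := orthonormal_free oe; have /dimvS := subvf <<c *: (u - \sum_(e <- s) form u e *: e) :: s>>.
by move=> h1 h2; rewrite h2 /= ss ltnn in h1.
Qed.

Definition orthonormal_triple e1 e2 e3 :=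
  [/\ form e1 e1 = 1, form e2 e2 = 1, form e3 e3 = 1 &
  [/\ form e1 e2 = 0, form e1 e3 = 0 & form e2 e3 = 0]].

(** Here dimension three enters: [e3] supplies the third axis that frame functions require. *)
Lemma two_vectors_in_plane u v : (3 <= \dim {:H})%N -> exists e1 e2 e3 a b c,
  [/\ orthonormal_triple e1 e2 e3, u = a *: e1 & v = b *: e1 + c *: e2].
Proof.
move=> d3; have o0 : orthonormal form [::] by [].
have [|e1 [a [o1 uE]]] := orthonormal_extend u o0; first by apply: leq_trans d3.
have [|e2 [c [o2 vE]]] := orthonormal_extend v o1; first by apply: leq_trans d3.
have [|e3 [_ [/orthonormalP [us os] _]]] := orthonormal_extend 0 o2; first by apply: leq_trans d3.
exists e1, e2, e3, a, (form v e1), c; move: us; rewrite /= !inE => /and3P[].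
rewrite negb_or => /andP[n32 n31] n21 _; split.
- have m1 : e1 \in [:: e3; e2; e1] by rewrite !inE eqxx !orbT.
  have m2 : e2 \in [:: e3; e2; e1] by rewrite !inE eqxx !orbT.
  have m3 : e3 \in [:: e3; e2; e1] by rewrite !inE eqxx.
  split; [by rewrite os // eqxx..|split].
  + by rewrite os // eq_sym (negPf n21).
  + by rewrite os // eq_sym (negPf n31).
  + by rewrite os // eq_sym (negPf n32).
- by rewrite {1}uE big_nil addr0.
- by rewrite {1}vE big_seq1 addrC.
Qed.

End Basis.

(** The left side is the sum of the projections onto three orthogonal lines, applied to a vector
    with coefficients [a], [b], [c]; the hypotheses are the entries of the resolution of the
    identity. *)
Lemma resolution_module (K : comNzRingType) (V : lmodType K)
    (x1 y1 z1 x2 y2 z2 x3 y3 z3 i1 i2 i3 a b c : K) (e1 e2 e3 : V) :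
  x1 * x1 * i1 + x2 * x2 * i2 + x3 * x3 * i3 = 1 ->
  y1 * y1 * i1 + y2 * y2 * i2 + y3 * y3 * i3 = 1 ->
  z1 * z1 * i1 + z2 * z2 * i2 + z3 * z3 * i3 = 1 ->
  x1 * y1 * i1 + x2 * y2 * i2 + x3 * y3 * i3 = 0 ->
  x1 * z1 * i1 + x2 * z2 * i2 + x3 * z3 * i3 = 0 ->
  y1 * z1 * i1 + y2 * z2 * i2 + y3 * z3 * i3 = 0 ->
  ((x1 * a + y1 * b + z1 * c) * i1) *: (x1 *: e1 + y1 *: e2 + z1 *: e3) +
  ((x2 * a + y2 * b + z2 * c) * i2) *: (x2 *: e1 + y2 *: e2 + z2 *: e3) +
  ((x3 * a + y3 * b + z3 * c) * i3) *: (x3 *: e1 + y3 *: e2 + z3 *: e3) =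
  a *: e1 + b *: e2 + c *: e3.
Proof.
move=> r1 r2 r3 r4 r5 r6; rewrite !scalerDr !scalerA.
rewrite (AC (3*3*3) ((1*4*7)*(2*5*8)*(3*6*9))) /= -!scalerDl.
congr (_ *: _ + _ *: _ + _ *: _).
- transitivity (a * (x1 * x1 * i1 + x2 * x2 * i2 + x3 * x3 * i3) +
    b * (x1 * y1 * i1 + x2 * y2 * i2 + x3 * y3 * i3) +
    c * (x1 * z1 * i1 + x2 * z2 * i2 + x3 * z3 * i3)); first by ring.
  by rewrite r1 r4 r5; ring.
- transitivity (a * (x1 * y1 * i1 + x2 * y2 * i2 + x3 * y3 * i3) +
    b * (y1 * y1 * i1 + y2 * y2 * i2 + y3 * y3 * i3) +
    c * (y1 * z1 * i1 + y2 * z2 * i2 + y3 * z3 * i3)); first by ring.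
  by rewrite r2 r4 r6; ring.
- transitivity (a * (x1 * z1 * i1 + x2 * z2 * i2 + x3 * z3 * i3) +
    b * (y1 * z1 * i1 + y2 * z2 * i2 + y3 * z3 * i3) +
    c * (z1 * z1 * i1 + z2 * z2 * i2 + z3 * z3 * i3)); first by ring.
  by rewrite r3 r5 r6; ring.
Qed.

(** * The energy on real and complex planes *)

Section Planes.
Context {R : realType} {H : vectType R[i]} (form : inner_product H).
Variable mu : 'End(H) -> R.
Hypothesis mu_ge0 : forall P, orthogonal_projection form P -> 0 <= mu P.
Hypothesis muD : forall P Q, orthogonal_projection form P -> orthogonal_projection form Q ->
     (P \o Q)%VF = 0 -> mu (P + Q) = mu P + mu Q.
Implicit Types (u v : H).

Lemma measure_line_proj3 u v t : form u v = 0 -> form u t = 0 -> form v t = 0 ->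
  mu (line_proj form u + line_proj form v + line_proj form t) =
  mu (line_proj form u) + mu (line_proj form v) + mu (line_proj form t).
Proof.
move=> uv ut vt; have pu := line_proj_projection form u; have pv := line_proj_projection form v.
have pt := line_proj_projection form t; rewrite muD ?muD ?line_proj_orth //.
  by apply: projD; rewrite ?line_proj_orth.
by rewrite comp_lfunDl !line_proj_orth // addr0.
Qed.

(** The line projections of any orthogonal triple in the real span add up to the projection onto the
    complex span, so additivity of [mu] fixes the weight. *)
Lemma real_frame e1 e2 e3 : orthonormal_triple form e1 e2 e3 ->
  frame_function (mu (line_proj form e1 + line_proj form e2 + line_proj form e3))
    (fun x y z => mu (line_proj form (x%:C *: e1 + y%:C *: e2 + z%:C *: e3))).
Proof.
move=> [n1 n2 n3 [o12 o13 o23]].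
have o21 : form e2 e1 = 0 by rewrite formC o12 conjC0.
have o31 : form e3 e1 = 0 by rewrite formC o13 conjC0.
have o32 : form e3 e2 = 0 by rewrite formC o23 conjC0.
pose v x y z : H := x%:C *: e1 + y%:C *: e2 + z%:C *: e3.
have vv x y z x' y' z' : form (v x y z) (v x' y' z') = (x * x' + y * y' + z * z')%:C.
  rewrite /v !formDl !formDr !formZl !formZr !conj_real n1 n2 n3 o12 o13 o23 o21 o31 o32.
  by rewrite !rmorphD !rmorphM /=; ring.
split=> [c x y z c0|].
  rewrite -[in RHS](line_proj_scale form _ (_ : c%:C != 0)) ?fmorph_eq0 //.
  by rewrite !scalerDr !scalerA -!rmorphM.
move=> x1 y1 z1 x2 y2 z2 x3 y3 z3 s1 s2 s3 h1 h2 h3; rewrite -/(v x1 y1 z1) -/(v x2 y2 z2) -/(v x3 y3 z3).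
rewrite -measure_line_proj3 ?vv ?h1 ?h2 ?h3 //; congr mu; apply/lfunP => X.
rewrite !add_lfunE !line_projE !vv -!expr2 -/(sqn x1 y1 z1) -/(sqn x2 y2 z2) -/(sqn x3 y3 z3).
have [] := orthogonal_basis_resolution s1 s2 s3 h1 h2 h3.
rewrite n1 n2 n3 !divr1 -!fmorphV /=.
move: (_^-1) (_^-1) (_^-1) => i1 i2 i3 r1 r2 r3 [r4 r5 r6].
rewrite /v !formDr !formZr !conj_real.
have toC (p q : R) : p = q -> p%:C = q%:C by move->.
apply: resolution_module; rewrite -?rmorphM -?rmorphD ?r1 ?r2 ?r3 ?r4 ?r5 ?r6 //.
Qed.

Definition energy v : R := sqnorm form v * mu (line_proj form v).

Lemma energy_scale (c : R[i]) v : energy (c *: v) = sqnormc c * energy v.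
Proof.
have nE : sqnorm form (c *: v) = sqnormc c * sqnorm form v.
  rewrite /sqnorm formZl formZr form_sqnorm; case: c => a b /=.
  by rewrite /sqnormc /=; ring.
rewrite /energy nE -mulrA; have [->|c0] := eqVneq c 0; last by rewrite line_proj_scale.
by rewrite /sqnormc /= expr0n addr0 !mul0r.
Qed.

Lemma sqnorm_plane e1 e2 (x y : R) : form e1 e1 = 1 -> form e2 e2 = 1 -> form e1 e2 = 0 ->
  sqnorm form (x%:C *: e1 + y%:C *: e2) = x ^+ 2 + y ^+ 2.
Proof.
move=> n1 n2 o12; have o21 : form e2 e1 = 0 by rewrite formC o12 conjC0.
rewrite /sqnorm !formDl !formDr !formZl !formZr !conj_real n1 n2 o12 o21 /=.
by ring.
Qed.

Lemma energy_real_plane e1 e2 e3 : orthonormal_triple form e1 e2 e3 ->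
  exists r : R, forall x y : R, energy (x%:C *: e1 + y%:C *: e2)
    = energy e1 * x ^+ 2 + energy e2 * y ^+ 2 + r * (x * y).
Proof.
move=> o; have fF := real_frame o; have [n1 n2 n3 [o12 o13 o23]] := o.
have [|r rP] := frame_plane_quadratic fF.
  by move=> x y z _; apply: mu_ge0; apply: line_proj_projection.
exists r => x y; rewrite /energy sqnorm_plane // mulrC; move: (rP x y).
have c0 : (0 : R)%:C = 0 by []. have c1 : (1 : R)%:C = 1 by [].
rewrite c0 c1 !scale0r !scale1r !addr0 add0r => ->.
by rewrite /sqnorm n1 n2 /= !mul1r.
Qed.

Lemma sqnormc_conj (a : R[i]) : a * Num.conj a = (sqnormc a)%:C.
Proof. by case: a => p q; rewrite /sqnormc /=; simpc; congr (_ +i* _); ring. Qed.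

Lemma orthonormal_phase e1 e2 e3 w : sqnormc w = 1 ->
  orthonormal_triple form e1 e2 e3 -> orthonormal_triple form e1 (w *: e2) e3.
Proof.
move=> w1 [n1 n2 n3 [o12 o13 o23]]; split=> //; first by rewrite formZl formZr n2 mulr1 sqnormc_conj w1.
by split; rewrite // ?formZr ?formZl ?o12 ?o23 mulr0.
Qed.

(** [w *: e2] can replace [e2] in the triple; the mixed coefficient is read off at [x = y = 1]. *)
Lemma energy_phase_plane e1 e2 e3 w : sqnormc w = 1 -> orthonormal_triple form e1 e2 e3 ->
  forall x y : R, energy (x%:C *: e1 + (y%:C * w) *: e2) =
    energy e1 * x ^+ 2 + energy e2 * y ^+ 2 +
    (energy (e1 + w *: e2) - energy e1 - energy e2) * (x * y).
Proof.
move=> w1 o x y; have [r rP] := energy_real_plane (orthonormal_phase w1 o).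
have := rP 1 1; have c1 : (1 : R)%:C = 1 by [].
rewrite c1 !scale1r => E; rewrite -scalerA rP E !energy_scale w1.
by ring.
Qed.

(* [e1 + w e2], [|w| = 1], runs through the real plane spanned by [e1 + e2] and
   [i (e1 - e2)] up to phases: a second great circle of the Bloch sphere. *)
Lemma energy_circle e1 e2 e3 : orthonormal_triple form e1 e2 e3 ->
  exists r s t : R, forall w : R[i], sqnormc w = 1 ->
  energy (e1 + w *: e2) = t + r * complex.Re w + s * complex.Im w.
Proof.
move=> [n1 n2 n3 [o12 o13 o23]]; have o21 : form e2 e1 = 0 by rewrite formC o12 conjC0.
pose h : R := Num.sqrt (1 / 2); have h2 : h ^+ 2 = 1 / 2 by rewrite sqr_sqrtr // divr_ge0.
pose u := h%:C *: (e1 + e2); pose v := (0 +i* h) *: (e1 - e2).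
have o : orthonormal_triple form u v e3.
  have h2C : (h ^+ 2)%:C * 2 = 1 by rewrite -[2](rmorph_nat (real_complex R)) -rmorphM h2; congr (_%:C); field.
  have scale c x : form (c *: x) (c *: x) = (sqnormc c)%:C * form x x.
    by rewrite formZl formZr mulrA sqnormc_conj.
  have hh : sqnormc h%:C = h ^+ 2 by rewrite /sqnormc /=; ring.
  have hh' : sqnormc (0 +i* h) = h ^+ 2 by rewrite /sqnormc /=; ring.
  rewrite /u /v; split=> //.
  - rewrite scale formDl !formDr n1 n2 o12 o21 hh -[RHS]h2C; ring.
  - rewrite scale formBl !formBr n1 n2 o12 o21 hh' -[RHS]h2C; ring.
  - split.
    + by rewrite formZl formZr !formDl !formBr n1 n2 o12 o21; ring.
    + by rewrite formZl formDl o13 o23; ring.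
    + by rewrite formZl formBl o13 o23; ring.
have [r' rP] := energy_real_plane o.
exists (energy u - energy v), (- r'), (energy u + energy v) => w w1.
(* Half angles: if [w] is the square of [p + iq], then the real combination [p u - q v] is a
   multiple of [e1 + w *: e2]. *)
have := sqrtCK w; case: (sqrtC w) => p q E.
have N1 : p ^+ 2 + q ^+ 2 = 1.
  have : sqnormc ((p +i* q) ^+ 2) = 1 by rewrite E.
  rewrite sqnormcX /sqnormc /= => /eqP; rewrite sqrp_eq1; last by rewrite addr_ge0 ?sqr_ge0.
  by move/eqP.
have [w1E w2E] : complex.Re w = p ^+ 2 - q ^+ 2 /\ complex.Im w = 2 * (p * q).
  by rewrite -E expr2 /=; split; ring.
have vec : p%:C *: u + (- q)%:C *: v = (h%:C * (p -i* q)) *: (e1 + w *: e2).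
  rewrite /u /v !scalerDr !scalerN !scalerA -!scaleNr addrACA -!scalerDl.
  rewrite -E expr2; congr (_ *: _ + _ *: _); simpc; congr (_ +i* _); try by ring.
  - by transitivity (h * p * (p ^+ 2 + q ^+ 2)); [rewrite N1; ring | ring].
  - by transitivity (h * q * (p ^+ 2 + q ^+ 2)); [rewrite N1; ring | ring].
have := rP p (- q); rewrite vec energy_scale sqnormcM.
have -> : sqnormc h%:C = 1 / 2 by rewrite -h2 /sqnormc /=; ring.
have -> : sqnormc (p -i* q) = 1 by rewrite -N1 /sqnormc /=; ring.
rewrite w1E w2E => h1.
have q2 : q ^+ 2 = 1 - p ^+ 2 by rewrite -N1; ring.
move: h1; rewrite sqrrN q2; lra.
Qed.

(** Up to a phase the vector is [m *: e1 + (n * w) *: e2], with [m], [n] the moduli of [a], [b] and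
    [m * n * w = Num.conj a * b]. The circle formula makes the mixed coefficient linear in [w],
    whence the real and imaginary parts of [Num.conj a * b]. *)
Lemma energy_complex_plane e1 e2 e3 : orthonormal_triple form e1 e2 e3 ->
  exists r s : R, forall a b : R[i], energy (a *: e1 + b *: e2) =
    energy e1 * sqnormc a + energy e2 * sqnormc b +
    r * (complex.Re a * complex.Re b + complex.Im a * complex.Im b) +
    s * (complex.Re a * complex.Im b - complex.Im a * complex.Re b).
Proof.
move=> o; have [r [s [t circ]]] := energy_circle o; exists r, s => a b.
(* The values at [w = 1] and [w = -1] add up to [2 t] by the circle formula, and to twice the right
   side by the plane formula at (1, -1). *)
have t0 : t = energy e1 + energy e2.
  have p1 : sqnormc (1 : R[i]) = 1 by rewrite /sqnormc /=; ring.
  have m1 : sqnormc (-1 : R[i]) = 1 by rewrite /sqnormc /=; ring.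
  have := energy_phase_plane p1 o 1 (- 1).
  have := circ _ p1; have := circ _ m1; rewrite /= mulr1 rmorphN1 /=.
  have -> : (1 : R)%:C = 1 by [].
  rewrite !scale1r => -> -> ; lra.
have [->|a0] := eqVneq a 0.
  by rewrite scale0r add0r energy_scale /sqnormc /=; ring.
have [->|b0] := eqVneq b 0.
  by rewrite scale0r addr0 energy_scale /sqnormc /=; ring.
have N0 (c : R[i]) : c != 0 -> exists2 n : R, 0 < n & n ^+ 2 = sqnormc c.
  case: c => p q c0; have n0 : 0 < p ^+ 2 + q ^+ 2.
    rewrite lt0r addr_ge0 ?sqr_ge0 // andbT paddr_eq0 ?sqr_ge0 // !sqrf_eq0.
    by apply: contra c0 => /andP[/eqP -> /eqP ->].
  by exists (Num.sqrt (p ^+ 2 + q ^+ 2)); rewrite ?sqrtr_gt0 // sqr_sqrtr // ltW.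
have [m m0 mE] := N0 _ a0; have [n n0 nE] := N0 _ b0.
pose w := (m%:C * n%:C)^-1 * (Num.conj a * b).
have mC : m%:C != 0 by rewrite fmorph_eq0 gt_eqF.
have nC : n%:C != 0 by rewrite fmorph_eq0 gt_eqF.
have E1 : a *: e1 + b *: e2 = (a / m%:C) *: (m%:C *: e1 + (n%:C * w) *: e2).
  rewrite scalerDr !scalerA divfK //; congr (_ + _ *: _).
  have -> : a / m%:C * (n%:C * w) = (a * Num.conj a) * b / (m%:C) ^+ 2.
    by rewrite /w; field; rewrite mC nC.
  by rewrite sqnormc_conj -mE rmorphXn mulrAC divff ?mul1r // expf_neq0.
have sn (p : R) : sqnormc p%:C = p ^+ 2 by rewrite /sqnormc /=; ring.
have scj : sqnormc (Num.conj a) = sqnormc a by case: (a) => p q; rewrite /sqnormc /=; ring.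
have sV (c : R[i]) : c != 0 -> sqnormc c^-1 = (sqnormc c)^-1.
  move=> c0; have h1 : sqnormc c^-1 * sqnormc c = 1.
    by rewrite -sqnormcM mulVf // /sqnormc /=; ring.
  have h2 : sqnormc c != 0 by apply/eqP => z; move: h1; rewrite z mulr0 => /eqP; rewrite eq_sym oner_eq0.
  by rewrite -[LHS]mulr1 -(divff h2) mulrA h1 mul1r.
have w1 : sqnormc w = 1.
  rewrite /w sqnormcM sV ?mulf_neq0 // !sqnormcM !sn scj -mE -nE.
  by field; rewrite !gt_eqF.
have am1 : sqnormc (a / m%:C) = 1.
  by rewrite sqnormcM sV // sn -mE divff // expf_neq0 // gt_eqF.
rewrite E1 energy_scale am1 mul1r (energy_phase_plane w1 o) (circ _ w1) mE nE t0.
have wE : (m * n)%:C * w = Num.conj a * b by rewrite rmorphM /w mulrA divff ?mul1r // mulf_neq0.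
have [wR wI] : m * n * complex.Re w = complex.Re a * complex.Re b + complex.Im a * complex.Im b
    /\ m * n * complex.Im w = complex.Re a * complex.Im b - complex.Im a * complex.Re b.
  move: wE; case: (w) => w1' w2'; case: (a) => a1 a2; case: (b) => b1 b2 /=.
  by simpc => -[? ?]; split=> //=; lra.
by rewrite -wR -wI; ring.
Qed.

End Planes.

(** * The density operator *)

Section Density.
Context {R : realType} {H : vectType R[i]} (form : inner_product H).
Variable mu : 'End(H) -> R.
Hypothesis dim3 : (3 <= \dim {:H})%N.
Hypothesis mu0 : mu 0 = 0.
Hypothesis mu_ge0 : forall P, orthogonal_projection form P -> 0 <= mu P.
Hypothesis mu1 : mu \1%VF = 1.
Hypothesis muD : forall P Q, orthogonal_projection form P -> orthogonal_projection form Q ->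
     (P \o Q)%VF = 0 -> mu (P + Q) = mu P + mu Q.
Implicit Types (u v x y z : H) (P : 'End(H)) (a b c : R[i]).

Let E := energy form mu.

Lemma energy_parallelogram u v : E (u + v) + E (u - v) = 2 * E u + 2 * E v.
Proof.
have [e1 [e2 [e3 [a [b [c [o -> ->]]]]]]] := two_vectors_in_plane form u v dim3.
have [r [s F]] := energy_complex_plane mu_ge0 muD o; rewrite /E.
have -> : a *: e1 + (b *: e1 + c *: e2) = (a + b) *: e1 + c *: e2 by rewrite addrA scalerDl.
have -> : a *: e1 - (b *: e1 + c *: e2) = (a - b) *: e1 + (- c) *: e2.
  by rewrite opprD addrA scalerBl scaleNr.
have -> : a *: e1 = a *: e1 + 0 *: e2 by rewrite scale0r addr0.
by rewrite !F; case: a b c => [a1 a2] [b1 b2] [c1 c2]; rewrite /sqnormc /=; ring.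
Qed.

(** Real homogeneity of the polar form is read off in a plane containing both vectors, with no
    appeal to continuity. *)
Lemma energy_homogeneous (t : R) u v :
  E (t%:C *: u + v) - E (t%:C *: u) - E v = t * (E (u + v) - E u - E v).
Proof.
have [e1 [e2 [e3 [a [b [c [o -> ->]]]]]]] := two_vectors_in_plane form u v dim3.
have [r [s F]] := energy_complex_plane mu_ge0 muD o; rewrite /E.
have -> : t%:C *: (a *: e1) + (b *: e1 + c *: e2) = (t%:C * a + b) *: e1 + c *: e2.
  by rewrite scalerA addrA scalerDl.
have -> : a *: e1 + (b *: e1 + c *: e2) = (a + b) *: e1 + c *: e2 by rewrite addrA scalerDl.
rewrite scalerA.
have -> : (t%:C * a) *: e1 = (t%:C * a) *: e1 + 0 *: e2 by rewrite scale0r addr0.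
have -> : a *: e1 = a *: e1 + 0 *: e2 by rewrite scale0r addr0.
by rewrite !F; case: a b c => [a1 a2] [b1 b2] [c1 c2]; rewrite /sqnormc /=; ring.
Qed.

(** Four instances of the parallelogram law; this is additivity of the polar form [b]. *)
Lemma energy_third_difference x y z :
  E (x + y + z) = E (x + y) + E (x + z) + E (y + z) - E x - E y - E z.
Proof.
have h1 := energy_parallelogram (x + y) z; have h2 := energy_parallelogram x (y - z).
have h3 := energy_parallelogram (x + z) y; have h4 := energy_parallelogram y z.
have e1 : x + (y - z) = x + y - z by rewrite addrA.
have e2 : x - (y - z) = x + z - y by rewrite opprB addrA.
have e3 : x + z + y = x + y + z by rewrite addrAC.
by rewrite e1 e2 in h2; rewrite e3 in h3; lra.
Qed.

Let b u v : R := (E (u + v) - E u - E v) / 2.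
Let ii : R[i] := 0 +i* 1.

Lemma polarC u v : b u v = b v u.
Proof. by rewrite /b [u + v]addrC; lra. Qed.

Lemma polarD u u' v : b (u + u') v = b u v + b u' v.
Proof. by rewrite /b energy_third_difference; lra. Qed.

Lemma polarZ (t : R) u v : b (t%:C *: u) v = t * b u v.
Proof. by rewrite /b energy_homogeneous mulrA. Qed.

Lemma energy_ii u : E (ii *: u) = E u.
Proof. by rewrite /E energy_scale /sqnormc /=; ring. Qed.

Lemma polar_ii u v : b (ii *: u) (ii *: v) = b u v.
Proof. by rewrite /b -scalerDr !energy_ii. Qed.

Lemma polarN u v : b (- u) v = - b u v.
Proof. by rewrite -scaleN1r -[-1](rmorphN1 (real_complex R)) polarZ mulN1r. Qed.

Lemma ii2 u : ii *: (ii *: u) = - u.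
Proof. by rewrite scalerA -scaleN1r; congr (_ *: _); simpc. Qed.

Lemma polar_iil u v : b (ii *: u) v = - b u (ii *: v).
Proof. by rewrite -polar_ii ii2 polarN. Qed.

Lemma polar_diag u : b u u = E u.
Proof.
have -> : u = (1%:C) *: u by rewrite scale1r.
by rewrite /b -scalerDl /E !energy_scale /sqnormc /=; field.
Qed.

Lemma polar_iir u : b u (ii *: u) = 0.
Proof.
rewrite /b energy_ii; have -> : u + ii *: u = (1 + ii) *: u by rewrite scalerDl scale1r.
by rewrite /E energy_scale /sqnormc /=; field.
Qed.

(** The hermitian form with real part [b]. Multiplication by [ii] preserves the energy, hence is
    skew for [b], which yields complex linearity on the left and conjugate symmetry. *)
Definition gleason_form u v : R[i] := b u v +i* b u (ii *: v).
Let B := gleason_form.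

Lemma gleason_formD u u' v : B (u + u') v = B u v + B u' v.
Proof. by rewrite /B /gleason_form !polarD; simpc. Qed.

Lemma gleason_formZ a u v : B (a *: u) v = a * B u v.
Proof.
case: a => p q; have -> : (p +i* q) = p%:C + q%:C * ii by rewrite /ii; simpc.
rewrite scalerDl gleason_formD -scalerA /B /gleason_form !polarZ polar_iil polar_ii /ii.
by simpc; congr (_ +i* _); ring.
Qed.

Lemma gleason_formC u v : B v u = Num.conj (B u v).
Proof.
rewrite /B /gleason_form [b v u]polarC [b v (ii *: u)]polarC polar_iil //.
Qed.

Lemma gleason_form_diag u : B u u = (E u)%:C.
Proof. by rewrite /B /gleason_form polar_diag polar_iir. Qed.

Lemma gleason_form_sum s (k : H -> R[i]) v :
  B (\sum_(e <- s) k e *: e) v = \sum_(e <- s) k e * B e v.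
Proof.
elim: s => [|e s IH]; last by rewrite !big_cons gleason_formD gleason_formZ IH.
by rewrite !big_nil -(scale0r 0) gleason_formZ mul0r.
Qed.

(** Riesz representation on an orthonormal basis: [psi e] represents [B e], and [rho] sends [e] to
    [psi e]. *)
Lemma exists_representation : exists rho : 'End(H), forall u v, form (rho u) v = B u v.
Proof.
have [s [os sE]] := orthonormal_basis form.
pose psi e := \sum_(e' <- s) B e e' *: e'.
have psiE e v : form (psi e) v = B e v.
  rewrite /psi linear_sumlz gleason_formC [in RHS](sE v) gleason_form_sum rmorph_sum.
  apply: eq_bigr => x _; rewrite /= formZl rmorphM /= -gleason_formC mulrC.
  by congr (_ * _); exact: formC.
exists (\sum_(e <- s) outer form (psi e) e) => u v.
rewrite sum_lfunE linear_sumlz [in RHS](sE u) gleason_form_sum.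
by apply: eq_bigr => e _; rewrite /= outerE formZl psiE.
Qed.

Lemma exists_density : exists rho : 'End(H), density_operator form rho /\
  forall P, orthogonal_projection form P -> lfun_trace (rho \o P)%VF = (mu P)%:C.
Proof.
have [rho rhoE] := exists_representation; exists rho.
have E_ge0 u : 0 <= E u.
  rewrite /E /energy mulr_ge0 //; last exact: mu_ge0 (line_proj_projection _ _).
  by rewrite -ler0c -form_sqnorm dnorm_ge0.
(* Induction on rank: the line of a fixed vector [v] contributes [E v] divided by the squared length
   of [v], which is [mu] of that line. *)
have trP P : orthogonal_projection form P -> lfun_trace (rho \o P)%VF = (mu P)%:C.
  have [n] := ubnP (\dim (limg P)); elim: n P => // n IH P Pn pP.
  have [->|P0] := eqVneq P 0; first by rewrite comp_lfun0r lfun_trace0 mu0.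
  have [v v0 Pv] := proj_fixed P0 pP; have [pQ o lt] := proj_split pP Pv v0.
  have lt' : (\dim (limg (P - line_proj form v)%R) < n)%N by exact: leq_trans lt Pn.
  have -> : P = line_proj form v + (P - line_proj form v) by rewrite addrC subrK.
  rewrite comp_lfunDr lfun_traceD (IH _ lt' pQ).
  rewrite (muD (line_proj_projection form v) pQ o) rmorphD /=; congr (_ + _).
  rewrite trace_comp_line_proj rhoE gleason_form_diag /E /energy rmorphM /= -form_sqnorm.
  by rewrite mulrAC divff ?mul1r // dnorm_eq0.
split=> //; split; last by rewrite -[rho]comp_lfun1r trP ?mu1 //; exact: proj1.
split; first by move=> u v; rewrite rhoE formC rhoE gleason_formC.
by move=> u; rewrite rhoE gleason_form_diag ler0c.
Qed.

End Density.

(** * Uniqueness of the operator and the equivalences *)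

Lemma operator_of_quadratic (R : realType) (H : vectType R[i]) (form : inner_product H)
  (A A' : 'End(H)) : (forall v, form (A v) v = form (A' v) v) -> A = A'.
Proof.
move=> AE; pose D v := A v - A' v.
have D0 v : form (D v) v = 0 by rewrite formBl AE subrr.
have DD u v : D (u + v) = D u + D v by rewrite /D [A (u + v)]linearD [A' (u + v)]linearD /= opprD addrACA.
have DZ c v : D (c *: v) = c *: D v by rewrite /D [A (c *: v)]linearZ [A' (c *: v)]linearZ /= scalerBr.
have Duv u v : form (D u) v + form (D v) u = 0.
  by have := D0 (u + v); rewrite DD formDl !formDr !D0 add0r addr0.
apply/lfunP => u; apply/eqP; rewrite -subr_eq0.
apply/eqP; apply: (form_inj (form := form)) => v.
rewrite form0r formC -[A u - A' u]/(D u).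
(* Replacing [v] by [i v] changes the relative sign of the two terms of [Duv], so each of them
   vanishes. *)
have h1 := Duv u v; have := Duv u ((0 +i* 1) *: v).
rewrite DZ formZl formZr; have -> : form (D v) u = - form (D u) v.
  by apply/eqP; rewrite -addr_eq0 addrC h1.
have -> : Num.conj (0 +i* 1 : R[i]) = - (0 +i* 1) by simpc.
rewrite mulNr mulrN -opprD => /eqP; rewrite oppr_eq0 -mulrDl mulf_eq0.
have i0 : (0 +i* 1 : R[i]) + (0 +i* 1) != 0.
  by rewrite eq_complex /= negb_and -[1 + 1]/(2%:R) pnatr_eq0 orbT.
by rewrite (negPf i0) /= => /eqP ->; rewrite conjC0.
Qed.

Theorem theorem6p2 (R : realType) (H : vectType R[i]) (form : inner_product H)
    (d : nat) (dim_H : \dim {:H} = d) (d_ge3 : (3 <= d)%N)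
    (w : prob_assignment form) :
  (refinement_consistent w <-> context_independent w) /\
  (context_independent w <->
     exists! rho : 'End(H),
       density_operator form rho /\
       forall (M : measurement form) (P : 'End(H)) (PM : P \in outcomes M),
         (w M [` PM])%:C = lfun_trace (rho \o P)%VF).
Proof.
split; split.
- exact: refinement_context.
- by move=> ci M M' P PM PM' _; apply: ci.
- move=> ci; have [mu [mu0 muE mu_ge0 mu1 muD]] := context_independent_measure ci.
  have dim3 : (3 <= \dim {:H})%N by rewrite dim_H.
  have [rho [drho rhoE]] := exists_density dim3 mu0 mu_ge0 mu1 muD.
  exists rho; split.
    split=> // M P PM; have [pM _ _] := measurementP M; have [_ pP] := pM _ PM.
    by rewrite rhoE // muE.
  (* Every line projection of a nonzero vector is an outcome of some measurement, and its trace
     against an operator gives the quadratic form of that operator. *)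
  move=> rho' [_ rho'E]; apply: (operator_of_quadratic (form := form)) => v.
  have [->|v0] := eqVneq v 0; first by rewrite !form0r.
  have [M ME] := binary_measurement (line_proj_projection form v).
  have PM : line_proj form v \in outcomes M by rewrite ME mem_head line_proj_neq0.
  have := rho'E _ _ PM; rewrite muE -rhoE; last exact: line_proj_projection.
  rewrite !trace_comp_line_proj => /(congr1 (fun c => c * form v v)).
  by rewrite !divfK ?dnorm_eq0.
- move=> [rho [[_ rhoE] _]] M N P PM PN.
  by apply: (fmorph_inj (real_complex R)); rewrite /= !rhoE.
Qed.
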